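(* Let $R$ be a ring, let $(P,Q,\psi)$ be an $R$-system satisfying condition (FS) and let $J$ be a $\psi$-compatible two-sided ideal of $R$. Let $\iota_R^J:=\rho_J\circ\iota_R$, $\iota_Q^J:=\rho_J\circ\iota_Q$ and $\iota_P^J:=\rho_J\circ\iota_P$. Then $(\iota_P^J,\iota_Q^J,\iota_R^J,\mathcal{O}_{(P,Q,\psi)}(J))$ is a surjective covariant representation of $(P,Q,\psi)$ which is Cuntz-Pimsner invariant relative to $J$ and has the following property: (CP) If $(S,T,\sigma,B)$ is a covariant representation of $(P,Q,\psi)$ which is Cuntz-Pimsner invariant relative to $J$, then there exists a unique ring homomorphism $\eta^J_{(S,T,\sigma,B)}:\mathcal{O}_{(P,Q,\psi)}(J)\to B$ such that $\eta^J_{(S,T,\sigma,B)}\circ\iota_R^J=\sigma$, $\eta^J_{(S,T,\sigma,B)}\circ\iota_Q^J=T$ and $\eta^J_{(S,T,\sigma,B)}\circ\iota_P^J=S$. The representation $(\iota_P^J,\iota_Q^J,\iota_R^J,\mathcal{O}_{(P,Q,\psi)}(J))$ is, up to isomorphism in $\mathcal{C}_{(P,Q,\psi)}$, the unique surjective covariant representation of $(P,Q,\psi)$ which is Cuntz-Pimsner invariant relative to $J$ and possesses property (CP); in fact, if $(S,T,\sigma,B)$ is a surjective covariant representation of $(P,Q,\psi)$ which is Cuntz-Pimsner invariant relative to $J$ and $\phi:B\to\mathcal{O}_{(P,Q,\psi)}(J)$ is a ring homomorphism such that $\phi\circ\sigma=\iota_R^J$, $\phi\circ S=\iota_P^J$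 and $\phi\circ T=\iota_Q^J$, then $\phi$ is an isomorphism. Moreover, the ring homomorphism $\iota_R^J$ is injective if and only if $J$ is faithful, and the representation $(\iota_P^J,\iota_Q^J,\iota_R^J,\mathcal{O}_{(P,Q,\psi)}(J))$ is graded.
   Context: Rings are associative, not necessarily unital. For $R$-bimodules $P,Q$, $P\otimes Q$ is the $R$-balanced tensor product. ''Linear'' means additive. An $R$-system is a triple $(P,Q,\psi)$ where $P,Q$ are $R$-bimodules and $\psi:P\otimes Q\to R$ is an $R$-bimodule homomorphism. A covariant representation of $(P,Q,\psi)$ is a quadruple $(S,T,\sigma,B)$ where $B$ is a ring, $S:P\to B$ and $T:Q\to B$ are linear maps, $\sigma:R\to B$ is a ring homomorphism, and $S(pr)=S(p)\sigma(r)$, $S(rp)=\sigma(r)S(p)$, $T(qr)=T(q)\sigma(r)$, $T(rq)=\sigma(r)T(q)$, $\sigma(\psi(p\otimes q))=S(p)T(q)$ for all $r\in R,p\in P,q\in Q$. It is surjective if $B$ is generated as a ring by $\sigma(R)\cup T(Q)\cup S(P)$, injective if $\sigma$ is injective. A surjective covariant representation is graded if $B$ has a $\mathbb{Z}$-grading $\bigoplus_{n}B^{(n)}$ with $\sigma(R)\subseteq B^{(0)}$, $T(Q)\subseteq B^{(1)}$, $S(P)\subseteq B^{(-1)}$. $\mathcal{C}_{(P,Q,\psi)}$ is the category of surjective covariant representations, a morphism $(S_1,T_1,\sigma_1,B_1)\to(S_2,T_2,\sigma_2,B_2)$ being a ring homomorphism $\phi:B_1\to B_2$ with $\phi\circ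 T_1=T_2$, $\phi\circ S_1=S_2$, $\phi\circ\sigma_1=\sigma_2$. The Toeplitz representation $(\iota_P,\iota_Q,\iota_R,\mathcal{T}_{(P,Q,\psi)})$ is the (up to isomorphism unique) surjective covariant representation such that for every covariant representation $(S,T,\sigma,B)$ there is a unique ring homomorphism $\eta:\mathcal{T}_{(P,Q,\psi)}\to B$ with $\eta\circ\iota_R=\sigma$, $\eta\circ\iota_Q=T$, $\eta\circ\iota_P=S$; it exists and is injective. For $p\in P,q\in Q$: $\theta_{q,p}:Q\to Q$, $x\mapsto q\psi(p\otimes x)$, and $\theta_{p,q}:P\to P$, $y\mapsto\psi(y\otimes q)p$. $\mathcal{F}_P(Q)$ is the additive span of all $\theta_{q,p}$, $\mathcal{F}_Q(P)$ the additive span of all $\theta_{p,q}$. Condition (FS): for all finite sets $\{q_1,\dots,q_n\}\subseteq Q$, $\{p_1,\dots,p_m\}\subseteq P$ there exist $\Theta\in\mathcal{F}_P(Q)$ and $\Omega\in\mathcal{F}_Q(P)$ with $\Theta(q_i)=q_i$ and $\Omega(p_j)=p_j$ for all $i,j$. $\Delta:R\to\operatorname{End}(Q_R)$ is the ring homomorphism $\Delta(r)(q)=rq$. Under (FS), every covariant representation $(S,T,\sigma,B)$ induces a unique ring homomorphism $\pi_{T,S}:\mathcal{F}_P(Q)\to B$ with $\pi_{T,S}(\theta_{q,p})=T(q)S(p)$; put $\pi=\pi_{\iota_Q,\iota_P}$. A two-sided ideal $J$ of $R$ is $\psi$-compatible if $J\subseteq\Delta^{-1}(\mathcal{F}_P(Q))$;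 a $\psi$-compatible $J$ is faithful if $J\cap\ker\Delta=\{0\}$. For a $\psi$-compatible $J$, $\mathcal{T}(J)$ is the two-sided ideal of $\mathcal{T}_{(P,Q,\psi)}$ generated by $\{\iota_R(x)-\pi(\Delta(x)):x\in J\}$, $\mathcal{O}_{(P,Q,\psi)}(J):=\mathcal{T}_{(P,Q,\psi)}/\mathcal{T}(J)$, and $\rho_J$ is the quotient map. A covariant representation $(S,T,\sigma,B)$ is Cuntz-Pimsner invariant relative to $J$ if $\pi_{T,S}(\Delta(x))=\sigma(x)$ for every $x\in J$. *)

(* Defs.v *)
From HB Require Import structures.
From mathcomp Require Import all_boot all_order all_algebra.
From mathcomp Require Import generic_quotient ring_quotient.
From mathcomp Require Import boolp classical_sets functions.
From mathcomp Require Import freeg.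

Set Implicit Arguments.
Unset Strict Implicit.
Unset Printing Implicit Defensive.

Import GRing.Theory.

Local Open Scope classical_set_scope.
Local Open Scope quotient_scope.
Local Open Scope ring_scope.

Declare Scope nuring_scope.
Reserved Notation "x ** y" (at level 40, left associativity).
Reserved Notation "r *> m" (at level 40, left associativity).
Reserved Notation "m <* r" (at level 40, left associativity).

(* Associative, not necessarily unital, rings: MathComp rings all have a 1. *)
HB.mixin Record Zmodule_isNURing B of GRing.Zmodule B := {
  numul : B -> B -> B;
  numulA : associative numul;
  numulDl : left_distributive numul +%R;
  numulDr : right_distributive numul +%R }.

#[short(type="nuRingType")]
HB.structure Definition NURing :=
  {B of GRing.Zmodule B & Zmodule_isNURing B}.

Notation "x ** y" := (numul x y) : nuring_scope.
Local Open Scope nuring_scope.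

Section NURingTheory.
Variable B : nuRingType.
Implicit Types x y z : B.

Lemma numul0r x : 0 ** x = 0.
Proof. by apply: (@addrI _ (0 ** x)); rewrite -numulDl !addr0. Qed.
Lemma numulr0 x : x ** 0 = 0.
Proof. by apply: (@addrI _ (x ** 0)); rewrite -numulDr !addr0. Qed.
Lemma numulNr x y : (- x) ** y = - (x ** y).
Proof. by apply: (@addrI _ (x ** y)); rewrite -numulDl !subrr numul0r. Qed.
Lemma numulrN x y : x ** (- y) = - (x ** y).
Proof. by apply: (@addrI _ (x ** y)); rewrite -numulDr !subrr numulr0. Qed.
Lemma numulBl x y z : (x - y) ** z = x ** z - y ** z.
Proof. by rewrite numulDl numulNr. Qed.
Lemma numulBr x y z : x ** (y - z) = x ** y - x ** z.
Proof. by rewrite numulDr numulrN. Qed.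

Lemma numul_suml (I : Type) (r : seq I) (F : I -> B) y :
  (\sum_(i <- r) F i) ** y = \sum_(i <- r) F i ** y.
Proof. by apply: (big_morph (numul^~ y)) => [x z|]; rewrite ?numulDl ?numul0r. Qed.
Lemma numul_sumr (I : Type) (r : seq I) (F : I -> B) x :
  x ** (\sum_(i <- r) F i) = \sum_(i <- r) x ** F i.
Proof. by apply: (big_morph (numul x)) => [y z|]; rewrite ?numulDr ?numulr0. Qed.

End NURingTheory.

Definition nuring_morphism (A B : nuRingType) (f : A -> B) : Prop :=
  zmod_morphism f /\ {morph f : x y / x ** y}.

Definition nuring_isomorphism (A B : nuRingType) (f : A -> B) : Prop :=
  nuring_morphism f /\
  exists g : B -> A, [/\ nuring_morphism g, cancel f g & cancel g f].

Definition is_subgroup (V : zmodType) (D : set V) : Prop :=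
  D 0 /\ forall x y, D x -> D y -> D (x - y).

Definition is_subring (B : nuRingType) (D : set B) : Prop :=
  is_subgroup D /\ forall x y, D x -> D y -> D (x ** y).

Definition is_ideal (B : nuRingType) (I : set B) : Prop :=
  is_subgroup I /\ forall a x, I x -> I (a ** x) /\ I (x ** a).

Record subgroup (V : zmodType) :=
  Subgroup { subgroup_set :> V -> Prop; subgroupP : is_subgroup subgroup_set }.
Record subring (B : nuRingType) :=
  Subring { subring_set :> B -> Prop; subringP : is_subring subring_set }.
Record ideal (B : nuRingType) :=
  Ideal { ideal_set :> B -> Prop; idealP : is_ideal ideal_set }.

Lemma smallest_subgroup (V : zmodType) (A : set V) :
  is_subgroup (smallest (@is_subgroup V) A).
Proof.
split=> [D [[]]//|x y hx hy D [sD AD]].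
by apply: sD.2; [apply: hx|apply: hy].
Qed.

Lemma smallest_ideal (B : nuRingType) (A : set B) :
  is_ideal (smallest (@is_ideal B) A).
Proof.
split.
  split=> [D [[[]]]//|x y hx hy D [sD AD]].
  by apply: sD.1.2; [apply: hx|apply: hy].
move=> a x hx; split=> D [sD AD]; have [] // := sD.2 a x.
- exact: hx.
- exact: hx.
Qed.

Definition zspan (V : zmodType) (A : set V) : subgroup V :=
  Subgroup (smallest_subgroup A).

Definition ideal_gen (B : nuRingType) (A : set B) : ideal B :=
  Ideal (smallest_ideal A).

Definition generates_ring (B : nuRingType) (A : set B) : Prop :=
  smallest (@is_subring B) A = setT.

Section ZmodQuot.
Variables (V : zmodType) (N : subgroup V).

Definition subgroup_pred : V -> bool := fun x => `[< N x >].

Fact subgroup_pred_closed : zmod_closed subgroup_pred.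
Proof.
have [N0 NB] := subgroupP N.
by split=> [|x y /asboolP hx /asboolP hy]; apply/asboolP; [|exact: NB].
Qed.
HB.instance Definition _ :=
  GRing.isZmodClosed.Build V subgroup_pred subgroup_pred_closed.

Definition subgroup_closed : zmodClosed V :=
  GRing.ZmodClosed.clone V subgroup_pred _.

Definition zquot := Quotient.quot subgroup_closed.
HB.instance Definition _ := GRing.Zmodule.on zquot.

Definition zpi (x : V) : zquot := \pi_(Quotient.quot subgroup_closed) x.
Definition zrepr (x : zquot) : V := repr (x : Quotient.quot subgroup_closed).

Lemma zreprK : cancel zrepr zpi. Proof. exact: reprK. Qed.

Lemma zpiP x y : zpi x = zpi y <-> N (x - y).
Proof.
have e : `[< N (x - y) >] = (zpi x == zpi y).
  exact (Quotient.idealrBE subgroup_closed x y).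
split=> [/eqP|/asboolP]; first by rewrite -e => /asboolP.
by rewrite e => /eqP.
Qed.

Fact zpi_is_zmod_morphism : zmod_morphism zpi.
Proof. exact: (@pi_is_zmod_morphism _ _ _ (Quotient.quot subgroup_closed)). Qed.
HB.instance Definition _ := GRing.isZmodMorphism.Build V zquot zpi
  zpi_is_zmod_morphism.

Lemma zreprN x : N (zrepr (zpi x) - x).
Proof. by apply/zpiP; rewrite zreprK. Qed.

Lemma zpi_eq0 x : zpi x = 0 <-> N x.
Proof. by rewrite -[0](raddf0 zpi) zpiP subr0. Qed.

End ZmodQuot.

Definition subgroup_of_ideal (B : nuRingType) (I : ideal B) : subgroup B :=
  Subgroup (idealP I).1.

Section RingQuot.
Variables (B : nuRingType) (I : ideal B).

Definition rquot := zquot (subgroup_of_ideal I).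
HB.instance Definition _ := GRing.Zmodule.on rquot.

Definition rpi : B -> rquot := @zpi B (subgroup_of_ideal I).
HB.instance Definition _ := GRing.Additive.on rpi.

Definition rquot_mul (x y : rquot) : rquot := rpi (zrepr x ** zrepr y).

Fact rpi_mul x y : rpi (x ** y) = rquot_mul (rpi x) (rpi y).
Proof.
apply/zpiP.
set x' := zrepr (rpi x); set y' := zrepr (rpi y).
have Ix : I (x' - x) by apply/(@zpiP _ (subgroup_of_ideal I)); rewrite zreprK.
have Iy : I (y - y') by apply/(@zpiP _ (subgroup_of_ideal I)); rewrite zreprK.
have [[I0 IB] IM] := idealP I.
rewrite (_ : _ - _ = x ** (y - y') - ((x' - x) ** y')); last first.
  by rewrite numulBr numulBl opprB addrA subrK.
apply: IB; first exact: (IM _ _ Iy).1.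
exact: (IM _ _ Ix).2.
Qed.

Lemma rpi_surj (x : rquot) : exists y, x = rpi y.
Proof. by exists (zrepr x); exact: esym (zreprK x). Qed.

Fact rquot_mulA : associative rquot_mul.
Proof.
move=> x y z; have [[x' ->] [y' ->] [z' ->]] :=
  And3 (rpi_surj x) (rpi_surj y) (rpi_surj z).
by rewrite -!rpi_mul numulA.
Qed.

Fact rquot_mulDl : left_distributive rquot_mul +%R.
Proof.
move=> x y z; have [[x' ->] [y' ->] [z' ->]] :=
  And3 (rpi_surj x) (rpi_surj y) (rpi_surj z).
by rewrite -raddfD -!rpi_mul -raddfD numulDl.
Qed.

Fact rquot_mulDr : right_distributive rquot_mul +%R.
Proof.
move=> x y z; have [[x' ->] [y' ->] [z' ->]] :=
  And3 (rpi_surj x) (rpi_surj y) (rpi_surj z).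
by rewrite -raddfD -!rpi_mul -raddfD numulDr.
Qed.

HB.instance Definition _ := Zmodule_isNURing.Build rquot
  rquot_mulA rquot_mulDl rquot_mulDr.

Lemma rpi_morphism : nuring_morphism rpi.
Proof. by split; [exact: raddfB|exact: rpi_mul]. Qed.

End RingQuot.

Section SubringType.
Variables (B : nuRingType) (D : subring B).

Definition subring_pred : pred B := fun x => `[< D x >].

Fact subring_pred_closed : zmod_closed subring_pred.
Proof.
have [[D0 DB] _] := subringP D.
by split=> [|x y /asboolP hx /asboolP hy]; apply/asboolP; [|exact: DB].
Qed.
HB.instance Definition _ :=
  GRing.isZmodClosed.Build B subring_pred subring_pred_closed.

Record subring_type :=
  SubringElt { subring_val :> B; subring_valP : subring_pred subring_val }.
HB.instance Definition _ := [isSub for subring_val].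
HB.instance Definition _ := [Choice of subring_type by <:].
HB.instance Definition _ := [SubChoice_isSubZmodule of subring_type by <:].

Definition subring_elt (x : B) (Dx : D x) : subring_type :=
  SubringElt (introT (asboolP (D x)) Dx).

Lemma subring_eltP (x : subring_type) : D x.
Proof. exact/asboolP/subring_valP. Qed.

Definition subring_mul (x y : subring_type) : subring_type :=
  subring_elt ((subringP D).2 _ _ (subring_eltP x) (subring_eltP y)).

Fact subring_mulA : associative subring_mul.
Proof. by move=> x y z; apply: val_inj; exact: numulA. Qed.
Fact subring_mulDl : left_distributive subring_mul +%R.
Proof. by move=> x y z; apply: val_inj; exact: numulDl. Qed.
Fact subring_mulDr : right_distributive subring_mul +%R.
Proof. by move=> x y z; apply: val_inj; exact: numulDr. Qed.

HB.instance Definition _ := Zmodule_isNURing.Build subring_type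
  subring_mulA subring_mulDl subring_mulDr.

End SubringType.

HB.mixin Record Zmodule_isBimodule (R : nuRingType) M of GRing.Zmodule M := {
  lact : R -> M -> M;
  ract : M -> R -> M;
  lactDl : forall m, {morph lact^~ m : r s / r + s};
  lactDr : forall r, {morph lact r : m n / m + n};
  lactA : forall r s m, lact r (lact s m) = lact (r ** s) m;
  ractDl : forall r, {morph ract^~ r : m n / m + n};
  ractDr : forall m, {morph ract m : r s / r + s};
  ractA : forall m r s, ract (ract m r) s = ract m (r ** s);
  lractA : forall r m s, ract (lact r m) s = lact r (ract m s) }.

#[short(type="bimodType")]
HB.structure Definition Bimodule (R : nuRingType) :=
  {M of GRing.Zmodule M & Zmodule_isBimodule R M}.

Notation "r *> m" := (lact r m) : nuring_scope.
Notation "m <* r" := (ract m r) : nuring_scope.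

Definition bimodule_morphism (R : nuRingType) (M N : bimodType R)
    (f : M -> N) : Prop :=
  [/\ zmod_morphism f, forall r m, f (r *> m) = r *> f m
    & forall m r, f (m <* r) = f m <* r].

(* R as an R-bimodule over itself *)
Definition regular_bimod (R : nuRingType) : Type := R.
HB.instance Definition _ (R : nuRingType) :=
  GRing.Zmodule.on (regular_bimod R).
HB.instance Definition _ (R : nuRingType) :=
  Zmodule_isBimodule.Build R (regular_bimod R)
    (fun m r s => numulDl r s m) (fun r m n => numulDr r m n)
    (fun r s m => numulA r s m)
    (fun r m n => numulDl m n r) (fun m r s => numulDr m r s)
    (fun m r s => esym (numulA m r s)) (fun r m s => esym (numulA r m s)).

Section AdditiveMaps.
Variables (V W : zmodType) (f : V -> W).

Lemma zmod_morphismD : zmod_morphism f -> {morph f : x y / x + y}.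
Proof.
move=> fB x y; have f0 : f 0 = 0 by rewrite -(subrr 0) fB subrr.
have fN z : f (- z) = - f z by rewrite -sub0r fB f0 sub0r.
by rewrite -[in LHS](opprK y) fB fN opprK.
Qed.

Lemma morphD_zmod : {morph f : x y / x + y} -> zmod_morphism f.
Proof.
move=> fD x y; rewrite fD; congr (_ + _).
have f0 : f 0 = 0 by apply: (@addrI _ (f 0)); rewrite -fD !addr0.
by apply: (@addrI _ (f y)); rewrite -fD !subrr.
Qed.

End AdditiveMaps.

Section Tensor.
Variables (R : nuRingType) (P Q : bimodType R).

Definition freetens (p : P) (q : Q) : {freeg (P * Q) / int} := << (p, q) >>.

Definition tensor_relators : set {freeg (P * Q) / int} :=
  [set z | exists p p' q,
     z = freetens (p + p') q - freetens p q - freetens p' q] `|`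
  [set z | exists p q q',
     z = freetens p (q + q') - freetens p q - freetens p q'] `|`
  [set z | exists p r q, z = freetens (p <* r) q - freetens p (r *> q)].

(* The balanced tensor product of P and Q over R. *)
Definition tensor := zquot (zspan tensor_relators).
HB.instance Definition _ := GRing.Zmodule.on tensor.

Definition tens (p : P) (q : Q) : tensor := zpi _ (freetens p q).

Lemma tensDl p p' q : tens (p + p') q = tens p q + tens p' q.
Proof.
rewrite /tens -raddfD; apply/zpiP; rewrite opprD addrA.
by move=> D [_ AD]; apply: AD; left; left; exists p, p', q.
Qed.

Lemma tensDr p q q' : tens p (q + q') = tens p q + tens p q'.
Proof.
rewrite /tens -raddfD; apply/zpiP; rewrite opprD addrA.
by move=> D [_ AD]; apply: AD; left; right; exists p, q, q'.
Qed.

Lemma tens_bal p r q : tens (p <* r) q = tens p (r *> q).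
Proof. by apply/zpiP => D [_ AD]; apply: AD; right; exists p, r, q. Qed.

Definition tensor_lift (V : zmodType) (f : P -> Q -> V) (t : tensor) : V :=
  fglift (fun x : P * Q => f x.1 x.2 : zmodule V) (zrepr t).

Lemma tensor_ind (K : tensor -> Prop) :
  is_subgroup K -> (forall p q, K (tens p q)) -> forall t, K t.
Proof.
move=> [K0 KB] Kt t; rewrite -[t]zreprK; move: (zrepr t) => z.
have KN x : K x -> K (- x) by rewrite -sub0r; exact: KB.
have KD x y : K x -> K y -> K (x + y).
  by move=> Kx Ky; rewrite -[y]opprK; apply: KB => //; exact: KN.
rewrite -(freeg_sumE z) raddf_sum.
elim/big_ind: _ => // -[p q] _.
have Kn n : K (zpi (zspan tensor_relators) (<< n%:R *g (p, q) >>)).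
  rewrite -freegU_muln raddfMn.
  elim: n => [|n IHn]; first by rewrite mulr0n.
  by rewrite mulrS; apply: KD => //; exact: Kt.
case: (coeff _ _) => n; first by rewrite -[Posz n]natz; exact: Kn.
by rewrite NegzE -freegUN raddfN; apply: KN; rewrite -natz; exact: Kn.
Qed.

Lemma tensor_eq (V : zmodType) (f g : tensor -> V) :
    zmod_morphism f -> zmod_morphism g ->
  (forall p q, f (tens p q) = g (tens p q)) -> forall t, f t = g t.
Proof.
move=> fB gB fg; apply: tensor_ind => //; split=> [|x y ex ey].
  by rewrite -(subrr 0) fB gB !subrr.
by rewrite fB gB ex ey.
Qed.

Section Lift.
Variables (V : zmodType) (f : P -> Q -> V).
Hypothesis fDl : forall q, {morph f^~ q : p p' / p + p'}.
Hypothesis fDr : forall p, {morph f p : q q' / q + q'}.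
Hypothesis f_bal : forall p r q, f (p <* r) q = f p (r *> q).

Let F := fglift (fun x : P * Q => f x.1 x.2 : zmodule V).

Let FB : zmod_morphism F. Proof. exact: lift_is_additive. Qed.

Let F_tens p q : F (freetens p q) = f p q.
Proof. by rewrite /F liftU scale1r. Qed.

Let F_ker z : zspan tensor_relators z -> F z = 0.
Proof.
move=> hz; apply: (hz [set z | F z = 0]); split.
  split=> [|x y /= ex ey]; last by rewrite FB ex ey subrr.
  by rewrite /= -(subrr 0) FB subrr.
move=> _ [[[p [p' [q ->]]]|[p [q [q' ->]]]]|[p [r [q ->]]]] /=.
- by rewrite !FB !F_tens fDl addrAC addrK subrr.
- by rewrite !FB !F_tens fDr addrAC addrK subrr.
- by rewrite !FB !F_tens f_bal subrr.
Qed.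

Let F_pi z : tensor_lift f (zpi _ z) = F z.
Proof.
apply/eqP; rewrite -subr_eq0; apply/eqP; rewrite -FB.
by apply: F_ker; exact: zreprN.
Qed.

Lemma tensor_liftE p q : tensor_lift f (tens p q) = f p q.
Proof. by rewrite F_pi F_tens. Qed.

Lemma tensor_liftB : zmod_morphism (tensor_lift f).
Proof.
by move=> x y; rewrite -[x]zreprK -[y]zreprK -raddfB !F_pi FB.
Qed.

End Lift.
End Tensor.

Section TensorBimodule.
Variables (R : nuRingType) (P Q : bimodType R).
Local Notation PQ := (tensor P Q).

Definition tensor_lact (r : R) : PQ -> PQ :=
  tensor_lift (fun p q => tens (r *> p) q).
Definition tensor_ract (t : PQ) (r : R) : PQ :=
  tensor_lift (fun p q => tens p (q <* r)) t.

Fact tensor_lactE r p q : tensor_lact r (tens p q) = tens (r *> p) q.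
Proof.
apply: tensor_liftE => [q' p1 p2|p' q1 q2|p' s q'] /=.
- by rewrite lactDr tensDl.
- by rewrite tensDr.
- by rewrite -lractA tens_bal.
Qed.
Fact tensor_lactB r : zmod_morphism (tensor_lact r).
Proof.
apply: tensor_liftB => [q' p1 p2|p' q1 q2|p' s q'] /=.
- by rewrite lactDr tensDl.
- by rewrite tensDr.
- by rewrite -lractA tens_bal.
Qed.
Fact tensor_ractE p q r : tensor_ract (tens p q) r = tens p (q <* r).
Proof.
rewrite /tensor_ract.
apply: tensor_liftE => [q' p1 p2|p' q1 q2|p' s q'] /=.
- by rewrite tensDl.
- by rewrite ractDl tensDr.
- by rewrite tens_bal lractA.
Qed.
Fact tensor_ractB r : zmod_morphism (tensor_ract^~ r).
Proof.
apply: tensor_liftB => [q' p1 p2|p' q1 q2|p' s q'] /=.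
- by rewrite tensDl.
- by rewrite ractDl tensDr.
- by rewrite tens_bal lractA.
Qed.

Let addB (V W : zmodType) (f g : V -> W) :
  zmod_morphism f -> zmod_morphism g -> zmod_morphism (fun x => f x + g x).
Proof. by move=> fB gB x y; rewrite fB gB opprD addrACA. Qed.

Let compB (U V W : zmodType) (f : V -> W) (g : U -> V) :
  zmod_morphism f -> zmod_morphism g -> zmod_morphism (fun x => f (g x)).
Proof. by move=> fB gB x y; rewrite gB fB. Qed.

Fact tensor_lactDl t : {morph tensor_lact^~ t : r s / r + s}.
Proof.
move=> r s; apply: (@tensor_eq _ _ _ _ _ (fun t => tensor_lact r t + tensor_lact s t)) => [||p q].
- exact: tensor_lactB.
- by apply: addB; exact: tensor_lactB.
- by rewrite !tensor_lactE lactDl tensDl.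
Qed.
Fact tensor_lactDr r : {morph tensor_lact r : m n / m + n}.
Proof. exact/zmod_morphismD/tensor_lactB. Qed.
Fact tensor_lactA r s t :
  tensor_lact r (tensor_lact s t) = tensor_lact (r ** s) t.
Proof.
move: t; apply: tensor_eq => [||p q]; last by rewrite !tensor_lactE lactA.
- by apply: compB; exact: tensor_lactB.
- exact: tensor_lactB.
Qed.
Fact tensor_ractDl r : {morph tensor_ract^~ r : m n / m + n}.
Proof. exact/zmod_morphismD/tensor_ractB. Qed.
Fact tensor_ractDr t : {morph tensor_ract t : r s / r + s}.
Proof.
move=> r s; move: t.
apply: (@tensor_eq _ _ _ _ (tensor_ract^~ (r + s))
  (fun t => tensor_ract t r + tensor_ract t s)) => [||p q].
- exact: tensor_ractB.
- by apply: addB; exact: tensor_ractB.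
- by rewrite !tensor_ractE ractDr tensDr.
Qed.
Fact tensor_ractA t r s :
  tensor_ract (tensor_ract t r) s = tensor_ract t (r ** s).
Proof.
move: t; apply: (@tensor_eq _ _ _ _ (fun t => tensor_ract (tensor_ract t r) s)
  (tensor_ract^~ (r ** s))) => [||p q]; last by rewrite !tensor_ractE ractA.
- by apply: (@compB _ _ _ (tensor_ract^~ s)); exact: tensor_ractB.
- exact: tensor_ractB.
Qed.
Fact tensor_lractA r t s :
  tensor_ract (tensor_lact r t) s = tensor_lact r (tensor_ract t s).
Proof.
move: t; apply: (@tensor_eq _ _ _ _ (fun t => tensor_ract (tensor_lact r t) s)
  (fun t => tensor_lact r (tensor_ract t s))) => [||p q].
- by apply: (@compB _ _ _ (tensor_ract^~ s)); [exact: tensor_ractB|exact: tensor_lactB].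
- by apply: compB; [exact: tensor_lactB|exact: tensor_ractB].
- by rewrite tensor_lactE !tensor_ractE tensor_lactE.
Qed.

HB.instance Definition _ := Zmodule_isBimodule.Build R (tensor P Q)
  tensor_lactDl tensor_lactDr tensor_lactA tensor_ractDl tensor_ractDr
  tensor_ractA tensor_lractA.

Lemma lact_tens r (p : P) (q : Q) : r *> tens p q = tens (r *> p) q.
Proof. exact: tensor_lactE. Qed.
Lemma tens_ract (p : P) (q : Q) r : tens p q <* r = tens p (q <* r).
Proof. exact: tensor_ractE. Qed.

End TensorBimodule.

Record rsystem (R : nuRingType) := RSystem {
  sysP : bimodType R;
  sysQ : bimodType R;
  psi : tensor sysP sysQ -> regular_bimod R;
  psiP : bimodule_morphism psi }.

Record covrep (R : nuRingType) (X : rsystem R) := CovRep {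
  rep_ring :> nuRingType;
  repS : {additive sysP X -> rep_ring};
  repT : {additive sysQ X -> rep_ring};
  repR : R -> rep_ring;
  repRP : nuring_morphism repR;
  repS_ract : forall p r, repS (p <* r) = repS p ** repR r;
  repS_lact : forall r p, repS (r *> p) = repR r ** repS p;
  repT_ract : forall q r, repT (q <* r) = repT q ** repR r;
  repT_lact : forall r q, repT (r *> q) = repR r ** repT q;
  repR_psi : forall p q, repR (psi (tens p q)) = repS p ** repT q }.

Section CovRepTheory.
Variables (R : nuRingType) (X : rsystem R).

Definition rep_surjective (rho : covrep X) : Prop :=
  generates_ring (range (repR rho) `|` range (repT rho) `|` range (repS rho)).

Definition rep_morphism (rho1 rho2 : covrep X) (phi : rho1 -> rho2) : Prop :=
  [/\ nuring_morphism phi, phi \o repT rho1 = repT rho2,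
      phi \o repS rho1 = repS rho2 & phi \o repR rho1 = repR rho2].

Definition rep_isomorphic (rho1 rho2 : covrep X) : Prop :=
  exists (phi : rho1 -> rho2) (phi' : rho2 -> rho1),
    [/\ rep_morphism phi, rep_morphism phi', cancel phi phi'
      & cancel phi' phi].

Definition is_toeplitz (rho : covrep X) : Prop :=
  rep_surjective rho /\
  forall rho' : covrep X, exists! eta : rho -> rho', rep_morphism eta.

End CovRepTheory.

(* B is the internal direct sum of the subgroups G n, n : int *)
Definition is_grading (B : nuRingType) (G : int -> set B) : Prop :=
  [/\ forall n, is_subgroup (G n),
      forall m n x y, G m x -> G n y -> G (m + n) (x ** y),
      forall b, exists (s : seq int) (f : int -> B),
        (forall n, G n (f n)) /\ b = \sum_(n <- s) f n
    & forall (s : seq int) (f : int -> B), uniq s -> (forall n, G n (f n)) ->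
        \sum_(n <- s) f n = 0 -> {in s, forall n, f n = 0}].

Definition rep_graded (R : nuRingType) (X : rsystem R) (rho : covrep X) :
    Prop :=
  rep_surjective rho /\
  exists G : int -> set rho,
    [/\ is_grading G, range (repR rho) `<=` G 0, range (repT rho) `<=` G 1
      & range (repS rho) `<=` G (- 1)].

Section RightEndomorphisms.
Variables (R : nuRingType) (Q : bimodType R).

Definition right_linear_pred : pred (Q -> Q) := fun f =>
  `[< zmod_morphism f /\ forall q r, f (q <* r) = f q <* r >].

Let ractB r : zmod_morphism (fun q : Q => q <* r).
Proof. exact/morphD_zmod/ractDl. Qed.

Fact right_linear_pred_closed : zmod_closed right_linear_pred.
Proof.
split=> [|f g /asboolP[fB fr] /asboolP[gB gr]]; apply/asboolP.
  split=> [x y|q r]; first by rewrite subrr.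
  by have := ractB r 0 0; rewrite /= !subrr => ->.
have fgE z : (f - g) z = f z - g z by [].
split=> [x y|q r]; rewrite !fgE; first by rewrite fB gB !opprD !opprK addrACA.
by rewrite fr gr ractB.
Qed.
HB.instance Definition _ := GRing.isZmodClosed.Build (Q -> Q)
  right_linear_pred right_linear_pred_closed.

(* End(Q_R), with composition as product *)
Record rendo :=
  REndo { rendo_fun :> Q -> Q; rendoP : right_linear_pred rendo_fun }.
HB.instance Definition _ := [isSub for rendo_fun].
HB.instance Definition _ := [Choice of rendo by <:].
HB.instance Definition _ := [SubChoice_isSubZmodule of rendo by <:].

Definition mk_rendo (f : Q -> Q) (fB : zmod_morphism f)
    (fr : forall q r, f (q <* r) = f q <* r) : rendo :=
  REndo (introT (asboolP _) (conj fB fr)).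

Lemma rendoB (f : rendo) : zmod_morphism f.
Proof. by have /asboolP[] := rendoP f. Qed.
Lemma rendo_ract (f : rendo) q r : f (q <* r) = f q <* r.
Proof. by have /asboolP[_ ->] := rendoP f. Qed.
Lemma rendo_inj (f g : rendo) : (forall q, f q = g q) -> f = g.
Proof. by move=> fg; apply: val_inj; apply: funext. Qed.

Fact rendo_mulB (f g : rendo) : zmod_morphism (f \o g).
Proof. by move=> x y /=; rewrite !rendoB. Qed.
Fact rendo_mul_ract (f g : rendo) q r : (f \o g) (q <* r) = (f \o g) q <* r.
Proof. by rewrite /= !rendo_ract. Qed.

Definition rendo_mul (f g : rendo) : rendo :=
  mk_rendo (rendo_mulB f g) (rendo_mul_ract f g).

Fact rendo_mulA : associative rendo_mul.
Proof. by move=> f g h; apply: rendo_inj. Qed.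
Fact rendo_mulDl : left_distributive rendo_mul +%R.
Proof. by move=> f g h; apply: rendo_inj. Qed.
Fact rendo_mulDr : right_distributive rendo_mul +%R.
Proof.
move=> f g h; apply: rendo_inj => q.
exact: (zmod_morphismD (rendoB f)).
Qed.

HB.instance Definition _ := Zmodule_isNURing.Build rendo
  rendo_mulA rendo_mulDl rendo_mulDr.

Fact lact_rendoB (r : R) : zmod_morphism (fun q : Q => r *> q).
Proof. exact/morphD_zmod/lactDr. Qed.
Fact lact_rendo_ract (r : R) (q : Q) s : r *> (q <* s) = (r *> q) <* s.
Proof. by rewrite lractA. Qed.

Definition Delta (r : R) : rendo :=
  mk_rendo (lact_rendoB r) (lact_rendo_ract r).

End RightEndomorphisms.

Lemma zspan_seq (V : zmodType) (I : Type) (A : set V) (g : I -> V)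
    (n : I -> I) : (forall i, g (n i) = - g i) ->
    (forall v, A v -> exists i, v = g i) ->
  forall v, zspan A v -> exists s : seq I, v = \sum_(i <- s) g i.
Proof.
move=> gN Ag v hv; apply: (hv [set v | exists s, v = \sum_(i <- s) g i]).
split; last by move=> w /Ag[i ->]; exists [:: i]; rewrite big_seq1.
split; first by exists [::]; rewrite big_nil.
move=> _ _ [s ->] [t ->]; exists (s ++ map n t).
rewrite big_cat big_map /=; congr (_ + _).
by rewrite -sumrN; apply: eq_bigr => i _; rewrite gN.
Qed.

Lemma zspan_sum (V : zmodType) (I : Type) (A : set V) (g : I -> V) (s : seq I) :
  (forall i, A (g i)) -> zspan A (\sum_(i <- s) g i).
Proof.
move=> Ag D [[D0 DB] AD]; elim/big_ind: _ => [//|x y Dx Dy|i _].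
  by rewrite -[y]opprK; apply: (DB) => //; rewrite -sub0r; apply: (DB).
exact: AD.
Qed.

Section FiniteRank.
Variables (R : nuRingType) (X : rsystem R).
Local Notation P := (sysP X).
Local Notation Q := (sysQ X).

Fact theta_zmod_morphism (q : Q) (p : P) :
  zmod_morphism (fun x => q <* psi (tens p x)).
Proof.
have [psiB _ _] := psiP X; apply: morphD_zmod => x y.
by rewrite tensDr (zmod_morphismD psiB) ractDr.
Qed.
Fact theta_ract (q : Q) (p : P) x r :
  q <* psi (tens p (x <* r)) = (q <* psi (tens p x)) <* r.
Proof. by have [_ _ psir] := psiP X; rewrite -tens_ract psir ractA. Qed.

(* theta_{q,p} : Q -> Q *)
Definition theta (q : Q) (p : P) : rendo Q :=
  mk_rendo (theta_zmod_morphism q p) (theta_ract q p).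

(* theta_{p,q} : P -> P *)
Definition thetaP (p : P) (q : Q) : P -> P := fun y => psi (tens y q) *> p.

(* F_P(Q) and F_Q(P) *)
Definition FPQ : set (rendo Q) := zspan [set f | exists q p, f = theta q p].
Definition FQP : set (P -> P) := zspan [set f | exists p q, f = thetaP p q].

Definition condFS : Prop :=
  forall (qs : seq Q) (ps : seq P), exists (Th : rendo Q) (Om : P -> P),
    [/\ FPQ Th, FQP Om, {in qs, forall q, Th q = q}
      & {in ps, forall p, Om p = p}].

Lemma thetaN q p : theta (- q) p = - theta q p.
Proof.
have tB q1 q2 : theta (q1 - q2) p = theta q1 p - theta q2 p.
  apply: rendo_inj => x.
  exact: (morphD_zmod (@ractDl _ _ (psi (tens p x)))).
by rewrite -[- q]sub0r tB -(subrr 0) tB subrr sub0r.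
Qed.

Lemma thetaPN p q : thetaP (- p) q = - thetaP p q.
Proof.
have tB p1 p2 : thetaP (p1 - p2) q = thetaP p1 q - thetaP p2 q.
  apply: funext => x.
  exact: (morphD_zmod (@lactDr _ _ (psi (tens x q)))).
by rewrite -[- p]sub0r tB -(subrr 0) tB subrr sub0r.
Qed.

Lemma theta_mul q p q' p' :
  theta q p ** theta q' p' = theta (q <* psi (tens p q')) p'.
Proof.
apply: rendo_inj => x; have [_ _ psir] := psiP X.
change (q <* psi (tens p (q' <* psi (tens p' x))) =
        (q <* psi (tens p q')) <* psi (tens p' x)).
by rewrite -tens_ract psir ractA.
Qed.

Lemma FPQP f : FPQ f <->
  exists s : seq (Q * P), f = \sum_(x <- s) theta x.1 x.2.
Proof.
split=> [|[s ->]]; last by apply: zspan_sum => -[q p]; exists q, p.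
apply: (@zspan_seq _ _ _ _ (fun x => (- x.1, x.2))) => [x|_ [q [p ->]]].
  exact: thetaN.
by exists (q, p).
Qed.

Lemma FQP_seq f : FQP f ->
  exists s : seq (P * Q), f = \sum_(x <- s) thetaP x.1 x.2.
Proof.
apply: (@zspan_seq _ _ _ _ (fun x => (- x.1, x.2))) => [x|_ [p [q ->]]].
  exact: thetaPN.
by exists (p, q).
Qed.

Definition theta_seqM (s t : seq (Q * P)) : seq (Q * P) :=
  [seq (x.1 <* psi (tens x.2 y.1), y.2) | x <- s, y <- t].

Lemma theta_seqME (s t : seq (Q * P)) :
  \sum_(x <- theta_seqM s t) theta x.1 x.2 =
  (\sum_(x <- s) theta x.1 x.2) ** (\sum_(y <- t) theta y.1 y.2).
Proof.
rewrite big_allpairs_dep numul_suml; apply: eq_bigr => x _.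
by rewrite numul_sumr; apply: eq_bigr => y _; rewrite theta_mul.
Qed.

Fact FPQ_subring : is_subring FPQ.
Proof.
split; first exact: subgroupP.
by move=> f g /FPQP[s ->] /FPQP[t ->]; apply/FPQP; exists (theta_seqM s t);
  rewrite theta_seqME.
Qed.

Definition FPQ_ring : nuRingType := subring_type (Subring FPQ_subring).
Definition FPQ_elt (f : rendo Q) (Ff : FPQ f) : FPQ_ring :=
  subring_elt (D := Subring FPQ_subring) Ff.

Fact theta_FPQ q p : FPQ (theta q p).
Proof. by move=> D [_]; apply; exists q, p. Qed.

Definition is_pi (rho : covrep X) (f : FPQ_ring -> rho) : Prop :=
  nuring_morphism f /\
  forall q p, f (FPQ_elt (theta_FPQ q p)) = repT rho q ** repS rho p.

Section Pi.
Variable rho : covrep X.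
Local Notation val_seq s := (\sum_(x <- s) repT rho x.1 ** repS rho x.2).

Let seq_of (f : FPQ_ring) : seq (Q * P) :=
  sval (cid ((FPQP (val f)).1 (subring_eltP f))).

Let seq_ofP f : val f = \sum_(x <- seq_of f) theta x.1 x.2.
Proof. by rewrite /seq_of; case: cid. Qed.

Let pi0 (f : FPQ_ring) : rho := val_seq (seq_of f).

Let val_seq_eq (fs : condFS) (s t : seq (Q * P)) :
  \sum_(x <- s) theta x.1 x.2 = \sum_(x <- t) theta x.1 x.2 ->
  val_seq s = val_seq t.
Proof.
have [Th [Om [_ /FQP_seq[u uE] _ Omp]]] :=
  fs [::] ([seq x.2 | x <- s] ++ [seq x.2 | x <- t]).
have key v : {subset [seq x.2 | x <- v] <=
                     [seq x.2 | x <- s] ++ [seq x.2 | x <- t]} ->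
  val_seq v = \sum_(y <- u)
     repT rho ((\sum_(x <- v) theta x.1 x.2) y.2) ** repS rho y.1.
  move=> sv; transitivity
    (\sum_(x <- v) \sum_(y <- u)
       repT rho (theta x.1 x.2 y.2) ** repS rho y.1).
    rewrite [in LHS]big_seq [in RHS]big_seq; apply: eq_bigr => x xv.
    have /Omp : x.2 \in [seq x.2 | x <- s] ++ [seq x.2 | x <- t].
      by apply: sv; apply: map_f.
    rewrite uE fct_sumE => {1}<-.
    rewrite raddf_sum numul_sumr; apply: eq_bigr => y _.
    by rewrite repS_lact numulA -repT_ract.
  rewrite exchange_big; apply: eq_bigr => y _.
  rewrite -numul_suml -raddf_sum; congr (repT rho _ ** _).
  elim/big_rec2: _ => [//|x g h _ ->]. by [].
move=> e; rewrite !key ?e // => p; rewrite mem_cat => ->; rewrite ?orbT //.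
Qed.

Let val_seq_mul (s t : seq (Q * P)) :
  val_seq (theta_seqM s t) = val_seq s ** val_seq t.
Proof.
rewrite big_allpairs_dep numul_suml; apply: eq_bigr => x _.
rewrite numul_sumr; apply: eq_bigr => y _ /=.
by rewrite repT_ract repR_psi !numulA.
Qed.

Lemma pi_exists : condFS -> exists! f : FPQ_ring -> rho, is_pi f.
Proof.
move=> fs; exists pi0; split; last first.
  move=> g [[gB gM] gE]; apply: funext => f; rewrite /pi0.
  have gD := zmod_morphismD gB.
  have g0 : g 0 = 0 by rewrite -(subrr 0) gB subrr.
  have {2}-> : f = \sum_(x <- seq_of f) FPQ_elt (theta_FPQ x.1 x.2).
    by apply: val_inj; rewrite raddf_sum; exact: seq_ofP.
  rewrite (big_morph g gD g0); apply: eq_bigr => x _.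
  by rewrite gE.
have pi0E f s : val f = \sum_(x <- s) theta x.1 x.2 -> pi0 f = val_seq s.
  by move=> fE; apply: val_seq_eq => //; rewrite -fE -seq_ofP.
split; last by move=> q p; rewrite (pi0E _ [:: (q, p)]) ?big_seq1.
split.
  apply: morphD_zmod => f g; rewrite (pi0E _ (seq_of f ++ seq_of g)).
    by rewrite big_cat.
  by rewrite big_cat /= -!seq_ofP.
move=> f g; rewrite (pi0E _ (theta_seqM (seq_of f) (seq_of g))).
  exact: val_seq_mul.
by rewrite theta_seqME -!seq_ofP.
Qed.

(* pi_{T,S} *)
Definition pi_rep (fs : condFS) : FPQ_ring -> rho := sval (cid (pi_exists fs)).

Lemma pi_repP (fs : condFS) : is_pi (pi_rep fs).
Proof. by rewrite /pi_rep; case: cid => f []. Qed.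

End Pi.
End FiniteRank.

Section CuntzPimsner.
Variables (R : nuRingType) (X : rsystem R).

Definition psi_compatible (J : ideal R) : Prop :=
  forall x, J x -> FPQ (Delta (sysQ X) x).

Definition ideal_faithful (J : ideal R) : Prop :=
  [set x | J x /\ Delta (sysQ X) x = 0] = [set 0].

Variables (fs : condFS X) (J : ideal R) (JX : psi_compatible J).

(* Delta x, for x in J, as an element of F_P(Q) *)
Definition DeltaJ (x : R) (Jx : J x) : FPQ_ring X := FPQ_elt (JX Jx).

Definition CP_invariant (rho : covrep X) : Prop :=
  forall (x : R) (Jx : J x), pi_rep rho fs (DeltaJ Jx) = repR rho x.

(* tau stands for a Toeplitz representation (is_toeplitz); these are unique
   only up to isomorphism, so the constructions take it as a parameter. *)
Variable tau : covrep X.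

(* T(J) *)
Definition toeplitz_ideal : ideal tau :=
  ideal_gen [set y | exists (x : R) (Jx : J x),
                       y = repR tau x - pi_rep tau fs (DeltaJ Jx)].

(* O(J) *)
Definition CP_ring : nuRingType := rquot toeplitz_ideal.

Definition rho_J : tau -> CP_ring := rpi toeplitz_ideal.
HB.instance Definition _ := GRing.Additive.on rho_J.

Definition CP_S : sysP X -> CP_ring := rho_J \o repS tau.
Definition CP_T : sysQ X -> CP_ring := rho_J \o repT tau.
Definition CP_R : R -> CP_ring := rho_J \o repR tau.
HB.instance Definition _ := GRing.Additive.on CP_S.
HB.instance Definition _ := GRing.Additive.on CP_T.

Let rho_JM : {morph rho_J : x y / x ** y}.
Proof. exact: (rpi_morphism toeplitz_ideal).2. Qed.

Fact CP_RP : nuring_morphism CP_R.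
Proof.
have [RB RM] := repRP tau.
by split=> x y; rewrite /CP_R /= ?RB ?RM ?raddfB ?rho_JM.
Qed.
Fact CP_S_ract p r : CP_S (p <* r) = CP_S p ** CP_R r.
Proof. by rewrite /CP_S /= repS_ract rho_JM. Qed.
Fact CP_S_lact r p : CP_S (r *> p) = CP_R r ** CP_S p.
Proof. by rewrite /CP_S /= repS_lact rho_JM. Qed.
Fact CP_T_ract q r : CP_T (q <* r) = CP_T q ** CP_R r.
Proof. by rewrite /CP_T /= repT_ract rho_JM. Qed.
Fact CP_T_lact r q : CP_T (r *> q) = CP_R r ** CP_T q.
Proof. by rewrite /CP_T /= repT_lact rho_JM. Qed.
Fact CP_R_psi p q : CP_R (psi (tens p q)) = CP_S p ** CP_T q.
Proof. by rewrite /CP_R /= repR_psi rho_JM. Qed.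

(* (iota_P^J, iota_Q^J, iota_R^J, O(J)) *)
Definition CP_rep : covrep X :=
  CovRep CP_RP CP_S_ract CP_S_lact CP_T_ract CP_T_lact CP_R_psi.

Definition CP_property (rho0 : covrep X) : Prop :=
  forall rho : covrep X, CP_invariant rho ->
    exists! eta : rho0 -> rho, rep_morphism eta.

End CuntzPimsner.

Section ToeplitzExists.
Variables (R : nuRingType) (X : rsystem R).
Local Notation P := (sysP X).
Local Notation Q := (sysQ X).

Inductive tterm : Type :=
  | T0 | Tadd of tterm & tterm | Topp of tterm | Tmul of tterm & tterm
  | TS of P | TT of Q | TR of R.

Inductive teq : tterm -> tterm -> Prop :=
  | teq_refl x : teq x x
  | teq_sym x y : teq x y -> teq y x
  | teq_trans y x z : teq x y -> teq y z -> teq x z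
  | teq_add x x' y y' : teq x x' -> teq y y' -> teq (Tadd x y) (Tadd x' y')
  | teq_opp x x' : teq x x' -> teq (Topp x) (Topp x')
  | teq_mul x x' y y' : teq x x' -> teq y y' -> teq (Tmul x y) (Tmul x' y')
  | teq_addA x y z : teq (Tadd x (Tadd y z)) (Tadd (Tadd x y) z)
  | teq_addC x y : teq (Tadd x y) (Tadd y x)
  | teq_add0 x : teq (Tadd T0 x) x
  | teq_addN x : teq (Tadd (Topp x) x) T0
  | teq_mulA x y z : teq (Tmul x (Tmul y z)) (Tmul (Tmul x y) z)
  | teq_mulDl x y z : teq (Tmul (Tadd x y) z) (Tadd (Tmul x z) (Tmul y z))
  | teq_mulDr x y z : teq (Tmul x (Tadd y z)) (Tadd (Tmul x y) (Tmul x z))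
  | teq_SD p p' : teq (TS (p + p')) (Tadd (TS p) (TS p'))
  | teq_TD q q' : teq (TT (q + q')) (Tadd (TT q) (TT q'))
  | teq_RD r r' : teq (TR (r + r')) (Tadd (TR r) (TR r'))
  | teq_RM r r' : teq (TR (r ** r')) (Tmul (TR r) (TR r'))
  | teq_Sr p r : teq (TS (p <* r)) (Tmul (TS p) (TR r))
  | teq_Sl r p : teq (TS (r *> p)) (Tmul (TR r) (TS p))
  | teq_Tr q r : teq (TT (q <* r)) (Tmul (TT q) (TR r))
  | teq_Tl r q : teq (TT (r *> q)) (Tmul (TR r) (TT q))
  | teq_psi p q : teq (TR (psi (tens p q))) (Tmul (TS p) (TT q)).

HB.instance Definition _ := gen_eqMixin tterm.
HB.instance Definition _ := gen_choiceMixin tterm.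

Definition teqb (x y : tterm) : bool := `[< teq x y >].

Fact teqb_equiv : equiv_class_of teqb.
Proof.
split=> [x|x y|y x z].
- exact/asboolP/teq_refl.
- by apply/asboolP/asboolP; exact: teq_sym.
- by move=> /asboolP xy /asboolP yz; apply/asboolP; exact: teq_trans yz.
Qed.
Canonical teqb_rel := EquivRelPack teqb_equiv.
Canonical teqb_encModRel := defaultEncModRel teqb.

Definition toep := {eq_quot teqb}.
HB.instance Definition _ := Choice.on toep.

Let tp (x : tterm) : toep := \pi_toep x.
Let tr (x : toep) : tterm := repr x.

Let tpP x y : teq x y -> tp x = tp y.
Proof. by move=> xy; apply/eqmodP/asboolP. Qed.
Let tpE x y : tp x = tp y -> teq x y.
Proof. by move=> /eqmodP/asboolP. Qed.
Let trK x : tp (tr x) = x. Proof. exact: reprK. Qed.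
Let tprK x : teq (tr (tp x)) x. Proof. by apply: tpE; rewrite trK. Qed.

Definition toep_add (x y : toep) : toep := tp (Tadd (tr x) (tr y)).
Definition toep_opp (x : toep) : toep := tp (Topp (tr x)).
Definition toep_mul (x y : toep) : toep := tp (Tmul (tr x) (tr y)).

Let taddE x y : tp (Tadd x y) = toep_add (tp x) (tp y).
Proof. by apply/tpP/teq_add; apply: teq_sym; exact: tprK. Qed.
Let toppE x : tp (Topp x) = toep_opp (tp x).
Proof. by apply/tpP/teq_opp; apply: teq_sym; exact: tprK. Qed.
Let tmulE x y : tp (Tmul x y) = toep_mul (tp x) (tp y).
Proof. by apply/tpP/teq_mul; apply: teq_sym; exact: tprK. Qed.

Fact toep_addA : associative toep_add.
Proof.
move=> x y z; rewrite -(trK x) -(trK y) -(trK z) -!taddE.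
exact/tpP/teq_addA.
Qed.
Fact toep_addC : commutative toep_add.
Proof. by move=> x y; rewrite -(trK x) -(trK y) -!taddE; exact/tpP/teq_addC. Qed.
Fact toep_add0 : left_id (tp T0) toep_add.
Proof. by move=> x; rewrite -(trK x) -!taddE; exact/tpP/teq_add0. Qed.
Fact toep_addN : left_inverse (tp T0) toep_opp toep_add.
Proof.
by move=> x; rewrite -(trK x) -toppE -!taddE; exact/tpP/teq_addN.
Qed.
HB.instance Definition _ :=
  GRing.isZmodule.Build toep toep_addA toep_addC toep_add0 toep_addN.

Let tpD x y : tp (Tadd x y) = tp x + tp y. Proof. exact: taddE. Qed.

Fact toep_mulA : associative toep_mul.
Proof.
move=> x y z; rewrite -(trK x) -(trK y) -(trK z) -!tmulE.
exact/tpP/teq_mulA.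
Qed.
Fact toep_mulDl : left_distributive toep_mul +%R.
Proof.
move=> x y z; rewrite -(trK x) -(trK y) -(trK z) -tpD -!tmulE -tpD.
exact/tpP/teq_mulDl.
Qed.
Fact toep_mulDr : right_distributive toep_mul +%R.
Proof.
move=> x y z; rewrite -(trK x) -(trK y) -(trK z) -tpD -!tmulE -tpD.
exact/tpP/teq_mulDr.
Qed.
HB.instance Definition _ :=
  Zmodule_isNURing.Build toep toep_mulA toep_mulDl toep_mulDr.

Definition toepS (p : P) : toep := tp (TS p).
Definition toepT (q : Q) : toep := tp (TT q).
Definition toepR (r : R) : toep := tp (TR r).

Fact toepS_zmod_morphism : zmod_morphism toepS.
Proof.
by apply: morphD_zmod => p p'; rewrite -tpD; exact/tpP/teq_SD.
Qed.
HB.instance Definition _ :=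
  GRing.isZmodMorphism.Build P toep toepS toepS_zmod_morphism.
Fact toepT_zmod_morphism : zmod_morphism toepT.
Proof.
by apply: morphD_zmod => q q'; rewrite -tpD; exact/tpP/teq_TD.
Qed.
HB.instance Definition _ :=
  GRing.isZmodMorphism.Build Q toep toepT toepT_zmod_morphism.
Fact toepRP : nuring_morphism toepR.
Proof.
split; last by move=> r r'; rewrite -[RHS]tmulE; exact/tpP/teq_RM.
by apply: morphD_zmod => r r'; rewrite -tpD; exact/tpP/teq_RD.
Qed.
Fact toepS_ract p r : toepS (p <* r) = toepS p ** toepR r.
Proof. by rewrite -[RHS]tmulE; exact/tpP/teq_Sr. Qed.
Fact toepS_lact r p : toepS (r *> p) = toepR r ** toepS p.
Proof. by rewrite -[RHS]tmulE; exact/tpP/teq_Sl. Qed.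
Fact toepT_ract q r : toepT (q <* r) = toepT q ** toepR r.
Proof. by rewrite -[RHS]tmulE; exact/tpP/teq_Tr. Qed.
Fact toepT_lact r q : toepT (r *> q) = toepR r ** toepT q.
Proof. by rewrite -[RHS]tmulE; exact/tpP/teq_Tl. Qed.
Fact toepR_psi p q : toepR (psi (tens p q)) = toepS p ** toepT q.
Proof. by rewrite -[RHS]tmulE; exact/tpP/teq_psi. Qed.

Definition toeplitz : covrep X :=
  CovRep toepRP toepS_ract toepS_lact toepT_ract toepT_lact toepR_psi.

Fixpoint teval (rho : covrep X) (x : tterm) : rho :=
  match x with
  | T0 => 0
  | Tadd x y => teval rho x + teval rho y
  | Topp x => - teval rho x
  | Tmul x y => teval rho x ** teval rho y
  | TS p => repS rho p
  | TT q => repT rho q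
  | TR r => repR rho r
  end.

Lemma teval_teq rho x y : teq x y -> teval rho x = teval rho y.
Proof.
have [RB RM] := repRP rho.
elim=> {x y} /=; try congruence; move=> *;
  rewrite ?addrA ?add0r ?addNr ?numulA ?numulDl ?numulDr //.
- exact: addrC.
- exact: raddfD.
- exact: raddfD.
- exact: (zmod_morphismD RB).
- exact: repS_ract.
- exact: repS_lact.
- exact: repT_ract.
- exact: repT_lact.
- exact: repR_psi.
Qed.

Lemma toeplitz_is_toeplitz : is_toeplitz toeplitz.
Proof.
split.
  apply/seteqP; split=> // x _; rewrite -(trK x).
  move=> D [[[D0 DB] DM] AD].
  have DN y : D y -> D (- y) by rewrite -sub0r; exact: DB.
  elim: (tr x) => {x} [|x Dx y Dy|x Dx|x Dx y Dy|p|q|r].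
  - exact: D0.
  - by rewrite taddE -[tp y]opprK; apply: DB => //; exact: DN.
  - by rewrite toppE; exact: DN.
  - by rewrite tmulE; exact: DM.
  - by apply: AD; right; exists p.
  - by apply: AD; left; right; exists q.
  - by apply: AD; left; left; exists r.
move=> rho; exists (fun x => teval rho (tr x)); split.
  have evE x : teval rho (tr (tp x)) = teval rho x by exact/teval_teq/tprK.
  split; last 3 first.
  - by apply: funext => q; exact: evE.
  - by apply: funext => p; exact: evE.
  - by apply: funext => r; exact: evE.
  split; last by move=> x y; exact: evE.
  by apply: morphD_zmod => x y; exact: evE.
move=> eta [[eB eM] eT eS eR]; apply: funext => x.
have e0 : eta 0 = 0 by rewrite -(subrr 0) eB subrr.
rewrite -[in RHS](trK x); elim: (tr x) => {x} [|x ex y ey|x ex|x ex y ey|p|q|r] /=.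
- exact: esym e0.
- by rewrite ex ey tpD (zmod_morphismD eB).
- by rewrite ex toppE -[- eta _]sub0r -e0 -eB sub0r.
- by rewrite ex ey tmulE -eM.
- by rewrite -eS.
- by rewrite -eT.
- by rewrite -eR.
Qed.
End ToeplitzExists.

(* Main.v *)
(* The quotient O(J) inherits property (CP) from the universal property of the
   Toeplitz ring, and the uniqueness statements are the usual abstract nonsense.

   Grading. Replacing (S, T, sigma) by (S t^-1, T t, sigma) gives another
   Cuntz-Pimsner invariant representation, so (CP) yields a homomorphism
   O(J) -> O(J)[t, t^-1]; the component of degree n consists of the elements b
   sent to b t^n.

   Injectivity. Let the Toeplitz ring act on the coinduced Fock space
   F = prod_n Hom_R(P^{(x) n}, Z + R), where S evaluates and T multiplies by
   psi.
   On the generators of T(J), only the vacuum component survives, with values in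
   J; hence every element of T(J) acts with values in J and kills all components
   of large degree. If sigma(r) is such an operator, so is
   sigma(psi(p (x) rq)) = S(p) sigma(r) T(q), with a smaller bound on the
   degree. By induction psi(p (x) rq) = 0 for all p and q, hence rq = 0 for all
   q by (FS), and r is in J as seen on the vacuum; faithfulness of J gives
   r = 0. *)
From HB Require Import structures.
Require Import Defs.
From mathcomp Require Import all_boot all_order all_algebra.
From mathcomp Require Import boolp classical_sets functions.

Set Implicit Arguments.
Unset Strict Implicit.
Unset Printing Implicit Defensive.

Import GRing.Theory.

Local Open Scope classical_set_scope.
Local Open Scope ring_scope.
Local Open Scope nuring_scope.

(** * Additive maps and generation of rings *)

Section ZmodMorphisms.
Variables (V W : zmodType) (f : V -> W).
Hypothesis fB : zmod_morphism f.

Lemma zmod_morphism0 : f 0 = 0.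
Proof. by rewrite -(subrr 0) fB subrr. Qed.

Lemma zmod_morphism_sum (I : Type) (s : seq I) (F : I -> V) :
  f (\sum_(i <- s) F i) = \sum_(i <- s) f (F i).
Proof. exact: (big_morph f (zmod_morphismD fB) zmod_morphism0). Qed.

End ZmodMorphisms.

Lemma is_subgroupD (V : zmodType) (D : set V) x y :
  is_subgroup D -> D x -> D y -> D (x + y).
Proof.
move=> [D0 DB] Dx Dy; rewrite -[y]opprK; apply: (DB) => //.
by rewrite -sub0r; apply: (DB).
Qed.

Lemma generates_ring_ind (B : nuRingType) (A D : set B) :
  generates_ring A -> is_subring D -> A `<=` D -> forall b, D b.
Proof.
move=> gA sD AD b; have: [set: B] b by [].
by rewrite -gA; apply.
Qed.

Lemma rendo_sum (R : nuRingType) (M : bimodType R) (I : Type) (s : seq I)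
    (F : I -> rendo M) m :
  (\sum_(i <- s) F i) m = \sum_(i <- s) F i m.
Proof. by elim/big_rec2: _ => // i y1 y2 _ <-. Qed.

(** * Morphisms of covariant representations *)

Section Representations.
Variables (R : nuRingType) (X : rsystem R).
Implicit Types rho : covrep X.

Lemma rep_surjective_ind rho (D : set rho) :
    rep_surjective rho -> is_subring D ->
    (forall p, D (repS rho p)) -> (forall q, D (repT rho q)) ->
    (forall r, D (repR rho r)) ->
  forall b, D b.
Proof.
move=> rhoS sD DS DT DR; apply: (generates_ring_ind rhoS sD).
by move=> _ [[[r _ <-]|[q _ <-]]|[p _ <-]].
Qed.

(** The equalizer of two morphisms is a subring containing the generators. *)
Lemma rep_morphism_uniq rho1 rho2 (f g : rho1 -> rho2) :
  rep_surjective rho1 -> rep_morphism f -> rep_morphism g -> f =1 g.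
Proof.
move=> rhoS [[fB fM] fT fS fR] [[gB gM] gT gS gR].
apply: (@rep_surjective_ind rho1 [set b | f b = g b]) => // [|p|q|r] /=.
- split; first split=> [|x y /= ex ey].
  + by rewrite /= (zmod_morphism0 fB) (zmod_morphism0 gB).
  + by rewrite fB gB ex ey.
  + by move=> x y /= ex ey; rewrite fM gM ex ey.
- exact: (congr1 (@^~ p) (etrans fS (esym gS))).
- exact: (congr1 (@^~ q) (etrans fT (esym gT))).
- exact: (congr1 (@^~ r) (etrans fR (esym gR))).
Qed.

Lemma rep_morphism_comp rho1 rho2 rho3 (f : rho1 -> rho2) (g : rho2 -> rho3) :
  rep_morphism f -> rep_morphism g -> rep_morphism (g \o f).
Proof.
move=> [[fB fM] fT fS fR] [[gB gM] gT gS gR]; split.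
- by split=> x y /=; rewrite ?fB ?fM ?gB ?gM.
- by rewrite -gT -fT.
- by rewrite -gS -fS.
- by rewrite -gR -fR.
Qed.

(** One decomposition into operators [theta] serves all representations at once, which makes the
    maps [pi_rep] comparable. *)
Lemma pi_rep_seq (fs : condFS X) (f : FPQ_ring X) :
  exists s : seq (sysQ X * sysP X),
    val f = \sum_(x <- s) theta x.1 x.2 /\
    forall rho, pi_rep rho fs f = \sum_(x <- s) repT rho x.1 ** repS rho x.2.
Proof.
have /FPQP[s sE] := subring_eltP f; exists s; split=> // rho.
have [[piB _] piE] := pi_repP rho fs.
have -> : f = \sum_(x <- s) FPQ_elt (theta_FPQ x.1 x.2).
  by apply: val_inj; rewrite raddf_sum; exact: sE.
by rewrite (zmod_morphism_sum piB); apply: eq_bigr => x _; rewrite piE.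
Qed.

Lemma rep_morphism_pi (fs : condFS X) rho1 rho2 (phi : rho1 -> rho2) f :
  rep_morphism phi -> phi (pi_rep rho1 fs f) = pi_rep rho2 fs f.
Proof.
have [s [_ piE]] := pi_rep_seq fs f; rewrite !piE => -[[pB pM] <- <- _].
by rewrite (zmod_morphism_sum pB); apply: eq_bigr => x _; rewrite pM.
Qed.

End Representations.

(** * The quotient O(J) and property (CP) *)

Section Relative.
Variables (R : nuRingType) (X : rsystem R) (fs : condFS X).
Variables (J : ideal R) (JX : psi_compatible X J).
Variables (tau : covrep X) (tauT : is_toeplitz tau).
Local Notation O := (CP_rep fs JX tau).
Local Notation rhoJ := (@rho_J R X fs J JX tau).

Lemma rho_J_rep_morphism : @rep_morphism _ _ tau O rhoJ.
Proof. by split=> //; exact: rpi_morphism. Qed.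

(** The preimage under [rho_J] of a subring containing the generators of O(J) is a subring
    containing those of [tau]. *)
Lemma CP_rep_surjective : rep_surjective O.
Proof.
have [[rB rM] rT rS rR] := rho_J_rep_morphism.
apply/seteqP; split=> // x _ D [[[D0 DB] DM] AD].
have [y ->] := rpi_surj x; move: y.
apply: (@rep_surjective_ind _ _ tau [set y | D (rhoJ y)] tauT.1).
- split; first split=> [|y z /= Dy Dz].
  + by rewrite /= (zmod_morphism0 rB).
  + by rewrite rB; exact: DB.
  + by move=> y z /= Dy Dz; rewrite rM; exact: DM.
- by move=> p; apply: AD; right; exists p.
- by move=> q; apply: AD; left; right; exists q.
- by move=> r; apply: AD; left; left; exists r.
Qed.

(** Naturality of pi lifts the identity to [tau], where the difference of the two sides is, up to
    sign, a generator of T(J). *)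
Lemma CP_rep_invariant : CP_invariant fs JX O.
Proof.
move=> x Jx; rewrite -(rep_morphism_pi _ _ rho_J_rep_morphism).
apply/esym/zpiP => D [_ AD]; apply: AD; by exists x, Jx.
Qed.

Lemma toeplitz_ideal_ind (D : set tau) :
    is_ideal D ->
    (forall x (Jx : J x), D (repR tau x - pi_rep tau fs (DeltaJ JX Jx))) ->
  forall y, toeplitz_ideal fs JX tau y -> D y.
Proof.
by move=> iD gD y; apply; split=> // _ [x [Jx ->]]; exact: gD.
Qed.

Lemma CP_repP : CP_property fs JX O.
Proof.
move=> rho rhoCP; have [eta [etaM _]] := tauT.2 rho.
have [[eB eM] eT eS eR] := etaM.
(* By naturality of pi, a generator of T(J) goes to sigma(x) - pi(Delta(x)) in [rho], which is zero
   by invariance. *)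
have ker y : toeplitz_ideal fs JX tau y -> eta y = 0.
  apply: (@toeplitz_ideal_ind [set y | eta y = 0]) => [|x Jx] /=; last first.
    rewrite eB (rep_morphism_pi _ _ etaM) rhoCP -eR.
    exact: subrr.
  split; first split=> [|y1 y2 /= e1 e2]; first exact: zmod_morphism0.
    by rewrite eB e1 e2 subrr.
  by move=> a y1 /= e1; rewrite !eM e1 numul0r numulr0.
(* The choice of representative is immaterial by [ker]. *)
pose etaJ (y : O) : rho := eta (zrepr y).
have etaJE y : etaJ (rhoJ y) = eta y.
  apply: subr0_eq; rewrite -eB; apply: ker.
  exact: (@zreprN _ (subgroup_of_ideal (toeplitz_ideal fs JX tau))).
have [[rB rM] rT rS rR] := rho_J_rep_morphism.
have etaJM : rep_morphism etaJ.
  split; last first.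
  - by rewrite -eR -rR; apply: funext => r /=; rewrite etaJE.
  - by rewrite -eS -rS; apply: funext => r /=; rewrite etaJE.
  - by rewrite -eT -rT; apply: funext => r /=; rewrite etaJE.
  split=> y z; have [y' ->] := rpi_surj y; have [z' ->] := rpi_surj z.
    by rewrite -[rpi _ y' - _]rB !etaJE eB.
  by rewrite -[rpi _ y' ** _]rM !etaJE eM.
exists etaJ; split=> // g gM; apply: funext.
exact: (rep_morphism_uniq CP_rep_surjective).
Qed.

End Relative.

(** * Uniqueness up to isomorphism *)

Section Universal.
Variables (R : nuRingType) (X : rsystem R) (fs : condFS X).
Variables (J : ideal R) (JX : psi_compatible X J).
Variables (rho0 : covrep X).
Hypotheses (rho0S : rep_surjective rho0) (rho0P : CP_property fs JX rho0).

(** Both composites are endomorphisms of surjective representations, hence equal to the identity by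
    [rep_morphism_uniq]. *)
Lemma CP_property_section (rho : covrep X) (phi : rho -> rho0) :
    rep_surjective rho -> CP_invariant fs JX rho -> rep_morphism phi ->
  exists eta : rho0 -> rho,
    [/\ rep_morphism eta, cancel phi eta & cancel eta phi].
Proof.
move=> rhoS rhoJ phiM; have [eta [etaM _]] := rho0P rhoJ.
exists eta; split=> // x.
- exact: (rep_morphism_uniq rhoS (rep_morphism_comp phiM etaM)).
- exact: (rep_morphism_uniq rho0S (rep_morphism_comp etaM phiM)).
Qed.

End Universal.

(** * Covariant representations by additive operators *)

(* The actions are zero, so that [rendo] of this bimodule is the ring of all
   additive endomorphisms of V. *)
Definition null_bimod (R : nuRingType) (V : zmodType) : Type := V.
HB.instance Definition _ (R : nuRingType) (V : zmodType) :=
  GRing.Zmodule.on (null_bimod R V).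

Section NullBimodule.
Variables (R : nuRingType) (V : zmodType).
Local Notation M := (null_bimod R V).
Let la (r : R) (m : M) : M := 0.
Let ra (m : M) (r : R) : M := 0.

Fact null_lactDl m : {morph la^~ m : r s / r + s}.
Proof. by move=> r s; rewrite /la addr0. Qed.
Fact null_lactDr r : {morph la r : m n / m + n}.
Proof. by move=> m n; rewrite /la addr0. Qed.
Fact null_lactA r s m : la r (la s m) = la (r ** s) m.
Proof. by []. Qed.
Fact null_ractDl r : {morph ra^~ r : m n / m + n}.
Proof. by move=> m n; rewrite /ra addr0. Qed.
Fact null_ractDr m : {morph ra m : r s / r + s}.
Proof. by move=> r s; rewrite /ra addr0. Qed.
Fact null_ractA m r s : ra (ra m r) s = ra m (r ** s).
Proof. by []. Qed.
Fact null_lractA r m s : ra (la r m) s = la r (ra m s).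
Proof. by []. Qed.

HB.instance Definition _ := Zmodule_isBimodule.Build R M
  null_lactDl null_lactDr null_lactA null_ractDl null_ractDr null_ractA
  null_lractA.
End NullBimodule.

Section OperatorRepresentation.
Variables (R : nuRingType) (X : rsystem R) (V : zmodType).
Local Notation P := (sysP X).
Local Notation Q := (sysQ X).
Variables (S : P -> V -> V) (T : Q -> V -> V) (A : R -> V -> V).
Hypotheses (S_morphl : forall v, zmod_morphism (S^~ v))
           (S_morphr : forall p, zmod_morphism (S p))
           (T_morphl : forall v, zmod_morphism (T^~ v))
           (T_morphr : forall q, zmod_morphism (T q))
           (A_morphl : forall v, zmod_morphism (A^~ v))
           (A_morphr : forall r, zmod_morphism (A r)).
Hypotheses (A_mul : forall r s v, A (r ** s) v = A r (A s v))
           (S_ract : forall p r v, S (p <* r) v = S p (A r v))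
           (S_lact : forall r p v, S (r *> p) v = A r (S p v))
           (T_ract : forall q r v, T (q <* r) v = T q (A r v))
           (T_lact : forall r q v, T (r *> q) v = A r (T q v))
           (A_psi : forall p q v, A (psi (tens p q)) v = S p (T q v)).

Local Notation E := (rendo (null_bimod R V)).

Fact null_rendo_ract (f : V -> V) (fB : zmod_morphism f)
    (v : null_bimod R V) (r : R) :
  f (v <* r) = (f v : null_bimod R V) <* r.
Proof. exact: zmod_morphism0. Qed.

Definition operator (f : V -> V) (fB : zmod_morphism f) : E :=
  @mk_rendo R (null_bimod R V) f fB (null_rendo_ract fB).

Definition op_S (p : P) : E := operator (S_morphr p).
Definition op_T (q : Q) : E := operator (T_morphr q).
Definition op_R (r : R) : E := operator (A_morphr r).

Fact op_S_zmod_morphism : zmod_morphism op_S.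
Proof. by move=> p p'; apply: rendo_inj => v; exact: S_morphl. Qed.
HB.instance Definition _ :=
  GRing.isZmodMorphism.Build P E op_S op_S_zmod_morphism.
Fact op_T_zmod_morphism : zmod_morphism op_T.
Proof. by move=> q q'; apply: rendo_inj => v; exact: T_morphl. Qed.
HB.instance Definition _ :=
  GRing.isZmodMorphism.Build Q E op_T op_T_zmod_morphism.
Fact op_RP : nuring_morphism op_R.
Proof.
split=> r s; apply: rendo_inj => v; [exact: A_morphl|exact: A_mul].
Qed.
Fact op_S_ract p r : op_S (p <* r) = op_S p ** op_R r.
Proof. by apply: rendo_inj => v; exact: S_ract. Qed.
Fact op_S_lact r p : op_S (r *> p) = op_R r ** op_S p.
Proof. by apply: rendo_inj => v; exact: S_lact. Qed.
Fact op_T_ract q r : op_T (q <* r) = op_T q ** op_R r.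
Proof. by apply: rendo_inj => v; exact: T_ract. Qed.
Fact op_T_lact r q : op_T (r *> q) = op_R r ** op_T q.
Proof. by apply: rendo_inj => v; exact: T_lact. Qed.
Fact op_R_psi p q : op_R (psi (tens p q)) = op_S p ** op_T q.
Proof. by apply: rendo_inj => v; exact: A_psi. Qed.

(** Serves twice: for sequences of Laurent coefficients and for the Fock space. *)
Definition op_rep : covrep X :=
  CovRep op_RP op_S_ract op_S_lact op_T_ract op_T_lact op_R_psi.

End OperatorRepresentation.

(** * Left multiplication on the unitization *)

Section Unitization.
Variable B : nuRingType.
Implicit Types (b c : B) (u v : int * B).

(* Left multiplication by B on its unitization. *)
Definition uact b u : int * B := (0, b *~ u.1 + b ** u.2).

Lemma uact_morphl u : zmod_morphism (uact^~ u).
Proof.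
by move=> b c; rewrite /uact mulrzBl numulBl addrACA -opprD /= -[0 in LHS]subr0.
Qed.

Lemma uact_morphr b : zmod_morphism (uact b).
Proof.
move=> u v; rewrite /uact /= mulrzBr numulBr addrACA -opprD.
by rewrite -[0 in LHS]subr0.
Qed.

Lemma numulMzr b c (n : int) : (b ** c) *~ n = b ** (c *~ n).
Proof.
case: n => n; rewrite ?NegzE ?mulrNz -?pmulrn ?numulrN.
  by elim: n => [|n IHn]; rewrite ?mulr0n ?numulr0 // !mulrS numulDr IHn.
congr (- _); elim: n.+1 => [|k IHk]; rewrite ?mulr0n ?numulr0 //.
by rewrite !mulrS numulDr IHk.
Qed.

Lemma uactM b c u : uact (b ** c) u = uact b (uact c u).
Proof. by rewrite /uact /= mulr0z add0r numulDr numulA numulMzr. Qed.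

(** The reason for the unitization: [B] may act on itself with a kernel, whereas the unit recovers
    [b]. *)
Lemma uact1 b : uact b (1, 0) = (0, b).
Proof. by rewrite /uact /= mulr1z numulr0 addr0. Qed.

End Unitization.

(** * The grading, through Laurent coefficients *)

Section Homogeneous.
Variables (R : nuRingType) (X : rsystem R) (rho : covrep X).
Variable G : int -> set rho.
Hypothesis Gsub : forall n, is_subgroup (G n).
Hypothesis GM : forall m n x y, G m x -> G n y -> G (m + n) (x ** y).
Hypotheses (GR : forall r, G 0 (repR rho r)) (GT : forall q, G 1 (repT rho q))
  (GS : forall p, G (- 1) (repS rho p)).

(** A homogeneous element with its degree. Lists of these may repeat degrees, so that sums and
    products of elements of [hsum] are immediate; equal degrees are collected only in
    [homogeneous_span]. *)
Let hom := {x : int * rho | G x.1 x.2}.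
Let hsum : set rho :=
  [set b | exists l : seq hom, b = \sum_(x <- l) (sval x).2].

Let hsum1 n b : G n b -> hsum b.
Proof. by move=> Gb; exists [:: exist _ (n, b) Gb]; rewrite big_seq1. Qed.

Let hsum_subring : is_subring hsum.
Proof.
split; first split.
- by exists [::]; rewrite big_nil.
- move=> _ _ [l ->] [m ->].
  have GN (x : hom) : G (sval x).1 (- (sval x).2).
    rewrite -sub0r; apply: (Gsub _).2; first exact: (Gsub _).1.
    exact: (proj2_sig x).
  exists (l ++ [seq exist (fun x => G x.1 x.2)
    ((sval x).1, - (sval x).2) (GN x) | x <- m]).
  by rewrite big_cat big_map /= sumrN.
- move=> _ _ [l ->] [m ->].
  have GMs (x y : hom) :
      G ((sval x).1 + (sval y).1) ((sval x).2 ** (sval y).2).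
    exact: GM (proj2_sig x) (proj2_sig y).
  exists [seq exist (fun x => G x.1 x.2)
    ((sval x).1 + (sval y).1, (sval x).2 ** (sval y).2) (GMs x y)
    | x <- l, y <- m].
  rewrite big_allpairs_dep numul_suml; apply: eq_bigr => x _.
  by rewrite numul_sumr.
Qed.

Lemma homogeneous_span : rep_surjective rho ->
  forall b, exists (s : seq int) (f : int -> rho),
    (forall n, G n (f n)) /\ b = \sum_(n <- s) f n.
Proof.
move=> rhoS b.
have [l ->] : hsum b.
  by apply: (@rep_surjective_ind _ _ rho hsum rhoS hsum_subring) => [p|q|r];
    apply: hsum1.
exists (undup [seq (sval x).1 | x <- l]).
exists (fun n => \sum_(x <- l | (sval x).1 == n) (sval x).2); split=> [n|].
  elim/big_ind: _ => [|x y|x /eqP <-]; 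
    [exact: (Gsub n).1| |exact: (proj2_sig x)].
  exact: is_subgroupD.
rewrite (exchange_big_dep predT) //=.
have: all (mem (undup [seq (sval x).1 | x <- l])) [seq (sval x).1 | x <- l].
  by apply/allP => n; rewrite /= mem_undup.
(* Only two facts about the list of degrees matter: it has no repetition and contains every degree
   that occurs. With [s] fixed in this generality, the induction on [l] goes through, each term
   being counted once. *)
move: (undup_uniq [seq (sval x).1 | x <- l]); move: (undup _) => s us.
rewrite all_map; elim: l => [|x m IHm]; first by rewrite !big_nil.
move=> /= /andP[xs ms]; rewrite !big_cons -IHm //; congr (_ + _).
rewrite -big_filter (eq_filter (a2 := pred1 (sval x).1)) => [|n].
  by rewrite filter_pred1_uniq // big_seq1.
by rewrite /= eq_sym.
Qed.
End Homogeneous.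

Section Laurent.
Variables (R : nuRingType) (X : rsystem R) (rho : covrep X).
Local Notation V := (int -> int * rho).

(* Multiplication by b t^n of f, read as a two-sided sequence of coefficients
   in the unitization of the ring of rho. *)
Definition laurent (n : int) (b : rho) (f : V) : V :=
  fun k => uact b (f (k - n)).

Lemma laurent_morphl n f : zmod_morphism (laurent n ^~ f).
Proof. by move=> b c; apply: funext => k; exact: uact_morphl. Qed.

Lemma laurent_morphr n b : zmod_morphism (laurent n b).
Proof. by move=> f g; apply: funext => k; exact: uact_morphr. Qed.

Lemma laurentM m n b c f :
  laurent (m + n) (b ** c) f = laurent m b (laurent n c f).
Proof. by apply: funext => k; rewrite /laurent uactM opprD addrA. Qed.

Lemma laurent_morph_comp (W : zmodType) (h : W -> rho) n f :
  zmod_morphism h -> zmod_morphism (fun w => laurent n (h w) f).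
Proof. by move=> hB x y; rewrite hB laurent_morphl. Qed.

(** The total degree is a variable of its own, so that sums of 0, 1 and -1 match by evaluation. *)
Fact laurentMe k m n b c f : m + n = k ->
  laurent k (b ** c) f = laurent m b (laurent n c f).
Proof. by move=> <-; exact: laurentM. Qed.

Let RB : zmod_morphism (repR rho) := (repRP rho).1.
Let RM : {morph repR rho : x y / x ** y} := (repRP rho).2.

Fact laurent_mul r s f : laurent 0 (repR rho (r ** s)) f =
  laurent 0 (repR rho r) (laurent 0 (repR rho s) f).
Proof. by rewrite RM; exact: laurentMe. Qed.
Fact laurent_S_ract p r f : laurent (- 1) (repS rho (p <* r)) f =
  laurent (- 1) (repS rho p) (laurent 0 (repR rho r) f).
Proof. by rewrite repS_ract; exact: laurentMe. Qed.
Fact laurent_S_lact r p f : laurent (- 1) (repS rho (r *> p)) f =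
  laurent 0 (repR rho r) (laurent (- 1) (repS rho p) f).
Proof. by rewrite repS_lact; exact: laurentMe. Qed.
Fact laurent_T_ract q r f : laurent 1 (repT rho (q <* r)) f =
  laurent 1 (repT rho q) (laurent 0 (repR rho r) f).
Proof. by rewrite repT_ract; exact: laurentMe. Qed.
Fact laurent_T_lact r q f : laurent 1 (repT rho (r *> q)) f =
  laurent 0 (repR rho r) (laurent 1 (repT rho q) f).
Proof. by rewrite repT_lact; exact: laurentMe. Qed.
Fact laurent_psi p q f : laurent 0 (repR rho (psi (tens p q))) f =
  laurent (- 1) (repS rho p) (laurent 1 (repT rho q) f).
Proof. by rewrite repR_psi; exact: laurentMe. Qed.

Definition laurent_rep : covrep X :=
  op_rep (fun f => laurent_morph_comp (-1) f (raddfB (repS rho)))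
    (fun p => laurent_morphr (-1) (repS rho p))
    (fun f => laurent_morph_comp 1 f (raddfB (repT rho)))
    (fun q => laurent_morphr 1 (repT rho q))
    (fun f => laurent_morph_comp 0 f RB)
    (fun r => laurent_morphr 0 (repR rho r))
    laurent_mul laurent_S_ract laurent_S_lact laurent_T_ract laurent_T_lact
    laurent_psi.

(** In each product T(q)t S(p)t^-1 the powers of t cancel, so pi(Delta(x)) acts in degree 0 exactly
    as in [rho]. *)
Lemma laurent_rep_CP (fs : condFS X) (J : ideal R) (JX : psi_compatible X J) :
  CP_invariant fs JX rho -> CP_invariant fs JX laurent_rep.
Proof.
move=> rhoJ x Jx; have [s [_ piE]] := pi_rep_seq fs (DeltaJ JX Jx).
rewrite piE; apply: rendo_inj => f; rewrite rendo_sum.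
change (\sum_(i <- s)
  laurent 1 (repT rho i.1) (laurent (- 1) (repS rho i.2) f) =
  laurent 0 (repR rho x) f).
rewrite -rhoJ piE (zmod_morphism_sum (laurent_morphl 0 f)).
by apply: eq_bigr => i _; rewrite -laurentM subrr.
Qed.

(* The component of degree n is the set of b that act as b t^n; since the
   coefficients are unital, such an action determines b. *)
Lemma laurent_graded (eta : rho -> laurent_rep) :
  rep_surjective rho -> rep_morphism eta -> rep_graded rho.
Proof.
move=> rhoS [[eB eM] eT eS eR]; split=> //.
pose act b : V -> V := eta b : rendo (null_bimod R V).
have actB b c f : act (b - c) f = act b f - act c f by rewrite /act eB.
have act0 f : act 0 f = 0 by rewrite -(subrr 0) actB subrr.
have actM b c f : act (b ** c) f = act b (act c f) by rewrite /act eM.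
pose G (n : int) : set rho := [set b | forall f, act b f = laurent n b f].
have Gsub n : is_subgroup (G n).
  split=> [f|b c Gb Gc f]; last by rewrite actB Gb Gc laurent_morphl.
  by rewrite act0 (zmod_morphism0 (laurent_morphl n f)).
have GM m n b c : G m b -> G n c -> G (m + n) (b ** c).
  by move=> Gb Gc f; rewrite actM Gc Gb laurentM.
have GR r : G 0 (repR rho r)
  by move=> f; rewrite /act -[eta _]/((eta \o repR rho) r) eR.
have GT q : G 1 (repT rho q)
  by move=> f; rewrite /act -[eta _]/((eta \o repT rho) q) eT.
have GS p : G (- 1) (repS rho p)
  by move=> f; rewrite /act -[eta _]/((eta \o repS rho) p) eS.
exists G; split; last 3 first.
- by move=> _ [r _ <-].
- by move=> _ [q _ <-].
- by move=> _ [p _ <-].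
split=> //; first exact: (@homogeneous_span _ _ rho G).
move=> s h us Gh h0 n ns.
(* The constant sequence 1 t^0. In the coefficient of t^n of the sum applied to it, only the term k
   = n survives, with value (0, h n). *)
pose e : V := fun k => if k == 0 then (1, 0) else 0.
have: act (\sum_(k <- s) h k) e n = 0 by rewrite h0 act0.
have evB : zmod_morphism (fun b => act b e n) by move=> b c; rewrite actB.
rewrite (zmod_morphism_sum evB).
rewrite (bigD1_seq n) //= Gh big1_seq => [|k /andP[kn _]]; last first.
  rewrite Gh /laurent /e subr_eq0 eq_sym (negbTE kn).
  exact: (zmod_morphism0 (@uact_morphr _ (h k))).
rewrite addr0 /laurent subrr /e eqxx uact1 => -[]; exact.
Qed.
End Laurent.

(** * Nondegeneracy of psi under (FS) *)

Section Pairing.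
Variables (R : nuRingType) (X : rsystem R).
Local Notation P := (sysP X).
Local Notation Q := (sysQ X).

Definition pair_psi (p : P) (q : Q) : R := psi (tens p q).

Lemma pair_psi_morphl q : zmod_morphism (pair_psi^~ q).
Proof.
have [psiB _ _] := psiP X; apply: morphD_zmod => p p'.
by rewrite /pair_psi tensDl (zmod_morphismD psiB).
Qed.

Lemma pair_psi_morphr p : zmod_morphism (pair_psi p).
Proof.
have [psiB _ _] := psiP X; apply: morphD_zmod => q q'.
by rewrite /pair_psi tensDr (zmod_morphismD psiB).
Qed.

Lemma pair_psi_lact r p q : pair_psi (r *> p) q = r ** pair_psi p q.
Proof. by have [_ psil _] := psiP X; rewrite /pair_psi -lact_tens psil. Qed.

Lemma pair_psi_ract p q r : pair_psi p (q <* r) = pair_psi p q ** r.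
Proof. by have [_ _ psir] := psiP X; rewrite /pair_psi -tens_ract psir. Qed.

Lemma pair_psi_bal p r q : pair_psi (p <* r) q = pair_psi p (r *> q).
Proof. by rewrite /pair_psi tens_bal. Qed.

Hypothesis fs : condFS X.

(** By (FS), p = Omega(p) is a sum of terms psi(p (x) q_i) p_i. *)
Lemma condFS_eq0P p : (forall q, pair_psi p q = 0) -> p = 0.
Proof.
move=> p0; have [_ [Om [_ /FQP_seq[s sE] _ Omp]]] := fs [::] [:: p].
rewrite -[LHS]Omp ?mem_head // sE fct_sumE big1 // => -[p' q] _.
rewrite /thetaP -[psi _]/(pair_psi p q) p0.
exact: (zmod_morphism0 (morphD_zmod (@lactDl _ _ p'))).
Qed.

Lemma condFS_eq0Q q : (forall p, pair_psi p q = 0) -> q = 0.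
Proof.
move=> q0; have [Th [_ [/FPQP[s sE] _ Thq _]]] := fs [:: q] [::].
rewrite -[LHS]Thq ?mem_head // sE rendo_sum big1 // => -[q' p] _.
rewrite /= -[psi _]/(pair_psi p q) q0.
exact: (zmod_morphism0 (morphD_zmod (@ractDr _ _ q'))).
Qed.

(** Right multiplication by x on P is adjoint to Delta(x), and [theta q p] to its mirror image on P;
    nondegeneracy then carries the decomposition from Q over to P, where Fock words live. *)
Lemma Delta_sum_ract x (s : seq (Q * P)) p :
  Delta Q x = \sum_(y <- s) theta y.1 y.2 ->
  p <* x = \sum_(y <- s) pair_psi p y.1 *> y.2.
Proof.
move=> sE; apply: subr0_eq; apply: condFS_eq0P => q.
rewrite pair_psi_morphl pair_psi_bal (zmod_morphism_sum (pair_psi_morphl q)).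
have -> : x *> q = \sum_(y <- s) theta y.1 y.2 q.
  by rewrite -rendo_sum -sE.
rewrite (zmod_morphism_sum (pair_psi_morphr p)) -sumrB big1 // => y _.
by rewrite pair_psi_lact -pair_psi_ract subrr.
Qed.

End Pairing.

(** The elements that multiply [K] into itself from both sides form a subring, so generators
    suffice. *)
Lemma rep_surjective_ideal (R : nuRingType) (X : rsystem R) (rho : covrep X)
    (K : set rho) :
    rep_surjective rho -> is_subgroup K ->
    (forall p x, K x -> K (repS rho p ** x) /\ K (x ** repS rho p)) ->
    (forall q x, K x -> K (repT rho q ** x) /\ K (x ** repT rho q)) ->
    (forall r x, K x -> K (repR rho r ** x) /\ K (x ** repR rho r)) ->
  is_ideal K.
Proof.
move=> rhoS sK KS KT KR; split=> // a.
apply: (@rep_surjective_ind _ _ rho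
  [set b | forall x, K x -> K (b ** x) /\ K (x ** b)]) => //.
split; first split=> [x Kx|b c Kb Kc x Kx].
- by rewrite numul0r numulr0; split; exact: sK.1.
- have [Kb1 Kb2] := Kb x Kx; have [Kc1 Kc2] := Kc x Kx.
  by rewrite numulBl numulBr; split; apply: sK.2.
- move=> b c Kb Kc x Kx; rewrite -numulA (numulA x).
  by split;
    [apply: (Kb _ _).1; apply: (Kc _ _).1|apply: (Kc _ _).2; apply: (Kb _ _).2].
Qed.

(** * The Fock representation *)

(* A Fock representation: f stands for a vector of the product of all the
   Hom_R(P^{(x) n}, Z + R), its n-fold tensor component being given by the
   values of f on words of length n, and sigma(r) acts on the P-factor that
   S evaluates first. *)
Section Fock.
Variables (R : nuRingType) (X : rsystem R).
Local Notation P := (sysP X).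
Local Notation Q := (sysQ X).
Local Notation word_fun := (seq P -> int * R).
Implicit Types (p : P) (q : Q) (r : R) (w u : seq P).

Definition word_act r (f : word_fun) : word_fun := fun w =>
  if w is p :: w' then f ((p <* r) :: w') else uact r (f [::]).

Definition word_create q (f : word_fun) : word_fun := fun w =>
  if w is p :: w' then word_act (pair_psi p q) f w' else 0.

Definition multilinear (f : word_fun) : Prop := forall u,
  (forall w, zmod_morphism (fun p => f (u ++ p :: w))) /\
  (forall r p w, f (u ++ (r *> p) :: w) =
    word_act r (fun w => f (u ++ p :: w)) w).

Lemma word_act_morphr r : zmod_morphism (word_act r).
Proof.
move=> f g; apply: funext => -[|p w] //=; exact: uact_morphr.
Qed.

Lemma word_act_morphl (f : word_fun) :
  multilinear f -> zmod_morphism (word_act^~ f).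
Proof.
move=> fM r s; apply: funext => -[|p w] /=; first exact: uact_morphl.
by rewrite (morphD_zmod (@ractDr _ _ p)) ((fM [::]).1 w).
Qed.

Lemma word_actM r s (f : word_fun) :
  word_act (r ** s) f = word_act r (word_act s f).
Proof. by apply: funext => -[|p w] /=; rewrite ?uactM ?ractA. Qed.

Lemma multilinear_behead (f : word_fun) p :
  multilinear f -> multilinear (fun w => f (p :: w)).
Proof. by move=> fM u; exact: (fM (p :: u)). Qed.

Lemma multilinear_act r (f : word_fun) :
  multilinear f -> multilinear (word_act r f).
Proof.
(* Only the first letter is altered; at later positions this is multilinearity of [f] with another
   prefix. *)
move=> fM [|p0 u]; last exact: (fM ((p0 <* r) :: u)).
split=> [w p p'|s p w] /=.
  by rewrite (morphD_zmod (@ractDl _ _ r)) ((fM [::]).1 w).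
by rewrite lractA ((fM [::]).2 s).
Qed.

Lemma multilinear_create q (f : word_fun) :
  multilinear f -> multilinear (word_create q f).
Proof.
move=> fM [|p0 u]; last exact: multilinear_act.
split=> [w p p'|s p w] /=.
  by rewrite pair_psi_morphl word_act_morphl.
by rewrite pair_psi_lact word_actM.
Qed.

Fact multilinear_closed :
  zmod_closed (fun f : word_fun => `[< multilinear f >]).
Proof.
split=> [|f g /asboolP fM /asboolP gM]; apply/asboolP => u.
  split=> [w p p'|r p [|p' w]] //=; first by rewrite subrr.
  exact/esym/(zmod_morphism0 (uact_morphr r)).
split=> [w p p'|r p w].
  by rewrite !fctE (fM u).1 (gM u).1 !opprD !opprK addrACA.
rewrite !fctE (fM u).2 (gM u).2.
exact: (congr1 (@^~ w) (esym (word_act_morphr r _ _))).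
Qed.
Definition multilinear_pred : pred word_fun := fun f => `[< multilinear f >].
HB.instance Definition _ :=
  GRing.isZmodClosed.Build word_fun multilinear_pred multilinear_closed.

Record fock := Fock { fock_fun :> word_fun; fockP : multilinear_pred fock_fun }.
HB.instance Definition _ := [isSub for fock_fun].
HB.instance Definition _ := [Choice of fock by <:].
HB.instance Definition _ := [SubChoice_isSubZmodule of fock by <:].

Implicit Types f g : fock.

Lemma fock_multilinear (f : fock) : multilinear f.
Proof. exact/asboolP/fockP. Qed.

Lemma fock_inj (f g : fock) : (forall w, f w = g w) -> f = g.
Proof. by move=> fg; apply: val_inj; apply: funext. Qed.

Definition mk_fock (f : word_fun) (fM : multilinear f) : fock :=
  Fock (introT (asboolP _) fM).

Definition fock_S p (f : fock) : fock :=
  mk_fock (multilinear_behead p (fock_multilinear f)).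
Definition fock_T q (f : fock) : fock :=
  mk_fock (multilinear_create q (fock_multilinear f)).
Definition fock_R r (f : fock) : fock :=
  mk_fock (multilinear_act r (fock_multilinear f)).

Fact fock_S_morphl f : zmod_morphism (fock_S^~ f).
Proof.
by move=> p p'; apply: fock_inj => w; exact: ((fock_multilinear f [::]).1 w).
Qed.
Fact fock_S_morphr p : zmod_morphism (fock_S p).
Proof. by move=> f g; apply: fock_inj. Qed.
Fact fock_T_morphl f : zmod_morphism (fock_T^~ f).
Proof.
move=> q q'; apply: fock_inj => -[|p w] /=; first exact: (esym (subrr _)).
rewrite pair_psi_morphr word_act_morphl //; exact: fock_multilinear.
Qed.
Fact fock_T_morphr q : zmod_morphism (fock_T q).
Proof.
move=> f g; apply: fock_inj => -[|p w] /=; first exact: (esym (subrr _)).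
exact: (congr1 (@^~ w) (word_act_morphr _ _ _)).
Qed.
Fact fock_R_morphl f : zmod_morphism (fock_R^~ f).
Proof.
move=> r s; apply: val_inj; exact: word_act_morphl (fock_multilinear f) _ _.
Qed.
Fact fock_R_morphr r : zmod_morphism (fock_R r).
Proof. by move=> f g; apply: val_inj; exact: word_act_morphr. Qed.
Fact fock_R_mul r s f : fock_R (r ** s) f = fock_R r (fock_R s f).
Proof. by apply: val_inj; exact: word_actM. Qed.
Fact fock_S_ract p r f : fock_S (p <* r) f = fock_S p (fock_R r f).
Proof. by apply: fock_inj. Qed.
Fact fock_S_lact r p f : fock_S (r *> p) f = fock_R r (fock_S p f).
Proof. by apply: fock_inj => w; exact: ((fock_multilinear f [::]).2 r p w). Qed.
Fact fock_T_ract q r f : fock_T (q <* r) f = fock_T q (fock_R r f).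
Proof.
by apply: fock_inj => -[|p w] //=; rewrite pair_psi_ract word_actM.
Qed.
Fact fock_T_lact r q f : fock_T (r *> q) f = fock_R r (fock_T q f).
Proof.
apply: fock_inj => -[|p w] /=; last by rewrite pair_psi_bal.
exact/esym/(zmod_morphism0 (uact_morphr r)).
Qed.
Fact fock_R_psi p q f : fock_R (psi (tens p q)) f = fock_S p (fock_T q f).
Proof. by apply: fock_inj. Qed.

Definition fock_rep : covrep X :=
  op_rep fock_S_morphl fock_S_morphr fock_T_morphl fock_T_morphr
    fock_R_morphl fock_R_morphr fock_R_mul fock_S_ract fock_S_lact
    fock_T_ract fock_T_lact fock_R_psi.

Fact vacuum_multilinear :
  multilinear (fun w => if w is [::] then (1, 0) else 0).
Proof.
move=> u; split=> [w p p'|r p w]; first by case: u => [|p0 u] /=; rewrite subrr.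
have -> : (fun w' => if u ++ p :: w' is [::] then (1, 0) else 0) =
    0 :> word_fun by apply: funext => w'; case: u.
rewrite (zmod_morphism0 (word_act_morphr r)).
by case: u.
Qed.
Definition vacuum : fock := mk_fock vacuum_multilinear.

(** Thanks to the unit of Z + R, the vacuum separates the elements of [R]. *)
Lemma fock_R_vacuum r : fock_R r vacuum [::] = (0, r).
Proof. exact: uact1. Qed.

(** * Operators with values in J and of bounded degree *)

Section Compact.
Variable J : ideal R.

Definition unital_ideal : set (int * R) := [set x | x.1 = 0 /\ J x.2].

Lemma unital_ideal_subgroup : is_subgroup unital_ideal.
Proof.
have [[J0 JB] _] := idealP J; split=> [//|x y [x1 x2] [y1 y2]].
by split; [rewrite /= x1 y1 subr0|exact: JB].
Qed.

Lemma uact_unital_ideal r x : unital_ideal x -> unital_ideal (uact r x).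
Proof.
move=> [x1 x2]; split=> //=; rewrite x1 mulr0z add0r.
exact: ((idealP J).2 r _ x2).1.
Qed.

Lemma uact_ideal r x : J r -> unital_ideal (uact r x).
Proof.
move=> Jr; have [sJ iJ] := idealP J; split=> //=.
have JM n : J (r *+ n).
  by elim: n => [|n IHn]; rewrite ?mulr0n ?mulrS;
    [exact: sJ.1|exact: is_subgroupD].
apply: (is_subgroupD sJ); last exact: (iJ _ _ Jr).2.
case: (x.1) => n; first exact: JM.
by rewrite NegzE mulrNz -sub0r; apply: sJ.2 (JM _); exact: sJ.1.
Qed.

(** The tail of the product, made of the tensor powers from n on. *)
Definition deep (n : nat) (f : fock) : Prop :=
  forall w, (size w < n)%N -> f w = 0.

Lemma deep_S n p f : deep n.+1 f -> deep n (fock_S p f).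
Proof. by move=> fn w wn; exact: fn. Qed.

Lemma deep_R n r f : deep n f -> deep n (fock_R r f).
Proof.
move=> fn [|p w] wn /=; last exact: fn.
by rewrite fn // (zmod_morphism0 (uact_morphr r)).
Qed.

Lemma deep_T n q f : deep n f -> deep n.+1 (fock_T q f).
Proof. by move=> fn [|p w] wn //=; exact: (deep_R (pair_psi p q) fn). Qed.

Lemma deepW n f : deep n.+1 f -> deep n f.
Proof. by move=> fn w wn; apply: fn; exact: ltnW. Qed.

(* On the image of the Toeplitz ring, the operators that only involve finitely
   many tensor powers and have coefficients in J. *)
Definition J_compact (A : fock -> fock) : Prop :=
  (forall f w, unital_ideal (A f w)) /\
  exists n, forall f, deep n f -> A f = 0.

Lemma J_compact0 : J_compact (fun=> 0).
Proof.
by split=> [f w|]; [exact: unital_ideal_subgroup.1|exists 0%N].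
Qed.

Lemma deep_leq m n f : (m <= n)%N -> deep n f -> deep m f.
Proof. by move=> mn fn w wm; apply: fn; exact: leq_trans mn. Qed.

Lemma J_compactB A B : J_compact A -> J_compact B ->
  J_compact (fun f => A f - B f).
Proof.
move=> [AJ [m Am]] [BJ [n Bn]]; split=> [f w|].
  exact: unital_ideal_subgroup.2.
exists (maxn m n) => f fmn; rewrite Am ?Bn ?subr0 //.
  exact: deep_leq (leq_maxr m n) fmn.
exact: deep_leq (leq_maxl m n) fmn.
Qed.

(** Composing on the left keeps the bound on the depth. On the right, [fock_S] costs one degree,
    [fock_R] and [fock_T] none. *)
Lemma J_compact_S A p :
  J_compact A -> J_compact (fock_S p \o A) /\ J_compact (A \o fock_S p).
Proof.
move=> [AJ [n An]]; split; split=> [f w|]; try exact: AJ.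
- by exists n => f fn /=; rewrite An // (zmod_morphism0 (fock_S_morphr p)).
- by exists n.+1 => f fn /=; apply: An; exact: deep_S.
Qed.

Lemma J_compact_R A r :
  J_compact A -> J_compact (fock_R r \o A) /\ J_compact (A \o fock_R r).
Proof.
move=> [AJ [n An]]; split; split=> [f w|]; try exact: AJ.
- by case: w => [|p w]; [exact: uact_unital_ideal|exact: AJ].
- by exists n => f fn /=; rewrite An // (zmod_morphism0 (fock_R_morphr r)).
- by exists n => f fn /=; apply: An; exact: deep_R.
Qed.

Lemma J_compact_T A q :
  J_compact A -> J_compact (fock_T q \o A) /\ J_compact (A \o fock_T q).
Proof.
move=> AK; have [AJ [n An]] := AK; split; split=> [f w|]; try exact: AJ.
- case: w => [|p w]; first exact: unital_ideal_subgroup.1.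
  exact: ((J_compact_R (pair_psi p q) AK).1.1 f w).
- by exists n => f fn /=; rewrite An // (zmod_morphism0 (fock_T_morphr q)).
- by exists n => f fn /=; apply: An; exact/deepW/deep_T.
Qed.

Lemma fock_R_compact_eq0 (fs : condFS X) r :
  ideal_faithful X J -> J_compact (fock_R r) -> r = 0.
Proof.
move=> faithJ [rJ [n rn]]; elim: n r rJ rn => [|n IHn] r rJ rn.
  (* With bound 0 there is no depth condition, so the operator vanishes on the vacuum, which detects
     [r]. *)
  have /rn : deep 0 vacuum by [].
  by move=> /(congr1 (fun f : fock => f [::])); rewrite fock_R_vacuum => -[].
have Jr : J r by have := rJ vacuum [::]; rewrite fock_R_vacuum => -[].
have Dr0 : Delta Q r = 0.
  (* By nondegeneracy it suffices that psi(p (x) rq) = 0. This scalar acts as S(p) sigma(r) T(q),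
     and T(q) raises the depth by one, so the bound drops from n+1 to n. *)
  apply: rendo_inj => q; apply: (condFS_eq0Q fs) => p.
  have STE f :
    fock_R (pair_psi p (r *> q)) f = fock_S p (fock_R r (fock_T q f)).
    by rewrite fock_R_psi fock_T_lact.
  apply: IHn => [f w|f fn]; rewrite STE; first exact: rJ.
  by rewrite rn ?(zmod_morphism0 (fock_S_morphr p)) //; exact: deep_T.
have: [set x | J x /\ Delta Q x = 0] r by [].
by rewrite faithJ.
Qed.

End Compact.
End Fock.

(** * Injectivity and faithfulness *)

Section Faithful.
Variables (R : nuRingType) (X : rsystem R) (fs : condFS X).
Variables (J : ideal R) (JX : psi_compatible X J).
Variables (tau : covrep X) (tauT : is_toeplitz tau).
Local Notation O := (CP_rep fs JX tau).

(** T vanishes on the empty word, which leaves sigma(x) alone there. On other words,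
    [Delta_sum_ract] rewrites the first letter times x, and multilinearity turns the result into the
    sum of the T(q)S(p). *)
Lemma fock_rep_defect x (Jx : J x) (f : fock X) w :
  (repR (fock_rep X) x - pi_rep (fock_rep X) fs (DeltaJ JX Jx) :
     rendo (null_bimod R (fock X))) f w =
  if w is [::] then uact x (f [::]) else 0.
Proof.
have [s [sE piE]] := pi_rep_seq fs (DeltaJ JX Jx); rewrite piE.
change ((fock_R x f - (\sum_(y <- s)
    repT (fock_rep X) y.1 ** repS (fock_rep X) y.2 :
    rendo (null_bimod R (fock X))) f : fock X) w =
  if w is [::] then uact x (f [::]) else 0).
rewrite rendo_sum.
have evB (v : seq (sysP X)) : zmod_morphism (fun g : fock X => g v) by [].
rewrite evB (zmod_morphism_sum (evB w)).
case: w => [|p w] /=; first by rewrite big1 ?subr0.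
have fB := (fock_multilinear f [::]).1 w.
apply/eqP; rewrite subr_eq0 (Delta_sum_ract fs p sE); apply/eqP.
rewrite (zmod_morphism_sum fB); apply: eq_bigr => y _.
exact: ((fock_multilinear f [::]).2 _ _ w).
Qed.

(** If Delta(x) = 0 with x in J, invariance makes the image of x in O(J) equal to pi(0) = 0. *)
Lemma CP_R_inj_faithful : injective (repR O) -> ideal_faithful X J.
Proof.
move=> Oinj; apply/seteqP; split=> x /=; last first.
  move=> ->; split; first exact: (idealP J).1.1.
  apply: rendo_inj => q.
  exact: (zmod_morphism0 (morphD_zmod (@lactDl _ _ q))).
move=> [Jx Dx]; apply: Oinj; rewrite (zmod_morphism0 (repRP O).1).
rewrite -(CP_rep_invariant fs JX tau Jx).
have -> : DeltaJ JX Jx = 0 by apply: val_inj.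
exact: (zmod_morphism0 (pi_repP O fs).1.1).
Qed.

Lemma faithful_CP_R_inj : ideal_faithful X J -> injective (repR O).
Proof.
move=> faithJ r1 r2 /zpiP rr; apply: subr0_eq.
have [eta [etaM _]] := tauT.2 (fock_rep X).
have [[eB eM] eT eS eR] := etaM.
pose op (y : tau) : fock X -> fock X := eta y : rendo (null_bimod R (fock X)).
(* An ideal containing the generators of T(J), hence T(J) itself. *)
pose K : set tau := [set y | J_compact J (op y)].
suff : K (repR tau (r1 - r2)).
  rewrite /K /= /op -[eta _]/((eta \o repR tau) _) eR.
  exact: fock_R_compact_eq0.
rewrite (repRP tau).1; apply: (toeplitz_ideal_ind _ _ rr) => [|x Jx].
  apply: (rep_surjective_ideal tauT.1).
  - split=> [|y z Ky Kz]; rewrite /K /= /op.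
      by rewrite (zmod_morphism0 eB); exact: J_compact0.
    by rewrite eB; exact: J_compactB.
  - move=> p y Ky; rewrite /K /= /op !eM.
    rewrite -[eta (repS _ _)]/((eta \o repS tau) p) eS.
    exact: J_compact_S.
  - move=> q y Ky; rewrite /K /= /op !eM.
    rewrite -[eta (repT _ _)]/((eta \o repT tau) q) eT.
    exact: J_compact_T.
  - move=> r y Ky; rewrite /K /= /op !eM.
    rewrite -[eta (repR _ _)]/((eta \o repR tau) r) eR.
    exact: J_compact_R.
rewrite /K /= /op eB (rep_morphism_pi _ _ etaM).
rewrite -[eta _]/((eta \o repR tau) x) eR.
split=> [f w|].
  rewrite fock_rep_defect; case: w => [|p w]; first exact: uact_ideal.
  exact: (unital_ideal_subgroup J).1.
(* The defect reads only the vacuum component, which vanishes from depth 1 on. *)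
exists 1%N => f f1; apply: fock_inj => -[|p w]; rewrite fock_rep_defect //.
by rewrite f1 // (zmod_morphism0 (uact_morphr x)).
Qed.

End Faithful.

(** * Assembly of the statements on O(J) *)

Theorem theorem3p18 (R : nuRingType) (X : rsystem R) (fs : condFS X)
    (J : ideal R) (JX : psi_compatible X J)
    (tau : covrep X) (tauT : is_toeplitz tau) :
  let O := CP_rep fs JX tau in
  [/\ rep_surjective O, CP_invariant fs JX O & CP_property fs JX O] /\
  (forall rho : covrep X,
     rep_surjective rho -> CP_invariant fs JX rho -> CP_property fs JX rho ->
     rep_isomorphic rho O) /\
  (forall (rho : covrep X) (phi : rho -> O),
     rep_surjective rho -> CP_invariant fs JX rho -> rep_morphism phi ->
     nuring_isomorphism phi) /\
  (injective (repR O) <-> ideal_faithful X J) /\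
  rep_graded O.
Proof.
move=> O.
have OS : rep_surjective O by exact: CP_rep_surjective.
have OJ : CP_invariant fs JX O by exact: CP_rep_invariant.
have OP : CP_property fs JX O by exact: CP_repP.
split=> //; split; [|split; [|split]].
(* Property (CP) of [rho] provides the morphism to O(J); that of O(J) makes it invertible. *)
- move=> rho rhoS rhoJ rhoP; have [phi [phiM _]] := rhoP O OJ.
  have [eta [etaM pe ep]] := CP_property_section OS OP rhoS rhoJ phiM.
  by exists phi, eta.
- move=> rho phi rhoS rhoJ phiM.
  have [eta [[etaM _ _ _] pe ep]] := CP_property_section OS OP rhoS rhoJ phiM.
  by have [phiR _ _ _] := phiM; split=> //; exists eta.
- by split; [exact: CP_R_inj_faithful|exact: faithful_CP_R_inj].
(* (CP) is applied to the Laurent representation built from O(J) itself. *)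
- have [eta [etaM _]] := OP _ (laurent_rep_CP OJ).
  exact: laurent_graded OS etaM.
Qed.
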